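(* For any $n$-graded double bracket $\{\!\!\{-,-\}\!\!\}$ ($n\in\mathbb{Z}$) in a graded algebra $A$ and any cyclic bilinear form $v$ on a counital coalgebra $M$, the induced bracket $\{-,-\}_v$ in $A_M$ is invariant under the action of the Lie algebra $\underline M^*$. As a consequence, the graded algebra $$A_M^M=(A_M)^{\underline M^*}=\{x\in A_M\mid\delta_\varphi(x)=0\text{ for all }\varphi\in\underline M^*\}$$ is closed under the bracket $\{-,-\}_v$.
   Context: All modules, (co)algebras and tensor products are over a fixed commutative ring $\mathbb{K}$. Algebras are associative, not necessarily unital; coalgebras are coassociative and not graded. Graded means $\mathbb{Z}$-graded, $|a|$ is the degree of a homogeneous element $a$, and $|a|_n=|a|+n$. Iterated comultiplication in $M$ with values in $M^{\otimes m}$ is written $\alpha\mapsto\alpha^1\otimes\cdots\otimes\alpha^m$ (summation suppressed). Elements of $A\otimes A$ are written $x=x'\otimes x''$ (summation suppressed, homogeneous factors). Representation algebra: $A_M$ is the graded algebra generated by symbols $a_\alpha$ ($a\in A$, $\alpha\in M$), $|a_\alpha|=|a|$, subject to bilinearity of $a_\alpha$ in $(a,\alpha)$, $(ab)_\alpha=a_{\alpha^1}b_{\alpha^2}$, and $a_\alpha b_\beta=(-1)^{|a||b|}b_\beta a_\alpha$ for homogeneous $a,b$. Double brackets: let $P_{21,n}(a\otimes b)=(-1)^{|a|_n|b|_n}b\otimes a$ and $P_{21}=P_{21,0}$. Put $a(x\otimes y)b=ax\otimes yb$ and $a*(x\otimes y)*b=(-1)^{|a||xb|+|b||y|}xb\otimes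 ay$. An $n$-graded double bracket in $A$ is a linear endomorphism $\{\!\!\{-,-\}\!\!\}$ of $A^{\otimes2}$ such that $\{\!\!\{A^p,A^q\}\!\!\}\subset\bigoplus_{i+j=p+q+n}A^i\otimes A^j$; $\{\!\!\{-,-\}\!\!\}P_{21,n}=-P_{21}\{\!\!\{-,-\}\!\!\}$; and for homogeneous $a,b,c$, $\{\!\!\{a,bc\}\!\!\}=\{\!\!\{a,b\}\!\!\}c+(-1)^{|a|_n|b|}b\{\!\!\{a,c\}\!\!\}$ and $\{\!\!\{ab,c\}\!\!\}=a*\{\!\!\{b,c\}\!\!\}+(-1)^{|b||c|_n}\{\!\!\{a,c\}\!\!\}*b$. Cyclic forms: a bilinear form $v:M\otimes M\to\mathbb{K}$ is cyclic if $\widehat v(\alpha\otimes\beta)=v(\alpha\otimes\beta^2)\beta^1\otimes\beta^3$ defines an endomorphism of $M\otimes M$ commuting with the flip of the factors. Induced bracket: an $n$-graded biderivation in a graded algebra $B$ is a linear map $\{-,-\}:B\otimes B\to B$ with $\{B^p,B^q\}\subset B^{p+q+n}$, $\{a,bc\}=\{a,b\}c+(-1)^{|a|_n|b|}b\{a,c\}$, $\{ab,c\}=a\{b,c\}+(-1)^{|b||c|_n}\{a,c\}b$, $\{a,b\}=-(-1)^{|a|_n|b|_n}\{b,a\}$ for homogeneous $a,b,c$. $\{-,-\}_v$ denotes the unique $n$-graded biderivation in $A_M$ such that $\{a_\alpha,b_\beta\}_v=v(\alpha\otimes\beta^2)\{\!\!\{a,b\}\!\!\}'_{\beta^1}\{\!\!\{a,b\}\!\!\}''_{\beta^3}$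 for all $a,b\in A$, $\alpha,\beta\in M$. Lie algebra action: $M^*=\mathrm{Hom}_{\mathbb{K}}(M,\mathbb{K})$ is an algebra with product $(\varphi\psi)(\alpha)=\varphi(\alpha^1)\psi(\alpha^2)$; $\underline M^*$ is the module $M^*$ with Lie bracket $[\varphi,\psi]=\varphi\psi-\psi\varphi$. Each $\varphi\in M^*$ determines a coderivation $\delta_\varphi(\alpha)=\varphi(\alpha^2)\alpha^1-\varphi(\alpha^1)\alpha^2$ of $M$, and $\varphi$ acts on $A_M$ by the degree-zero derivation, also denoted $\delta_\varphi$ (satisfying $\delta_\varphi(xy)=\delta_\varphi(x)y+x\delta_\varphi(y)$), with $\delta_\varphi(a_\alpha)=a_{\delta_\varphi(\alpha)}$. A bracket is invariant under this action if $\delta_\varphi(\{x,y\})=\{\delta_\varphi(x),y\}+\{x,\delta_\varphi(y)\}$ for all $\varphi$ and all $x,y$. *)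

(* Defs.v *)
From HB Require Import structures.
From mathcomp Require Import all_boot all_order all_algebra.
From mathcomp Require Import boolp.

Set Implicit Arguments.
Unset Strict Implicit.
Unset Printing Implicit Defensive.

Import GRing.Theory.
Local Open Scope ring_scope.
Local Open Scope quotient_scope.

Section TensorRel.
Variables (K : comPzRingType) (M N : lmodType K).

(* A list stands for the formal sum of the symbols m (x) n of its entries. *)
Inductive teq : seq (M * N) -> seq (M * N) -> Prop :=
| teq_refl s : teq s s
| teq_sym s t : teq s t -> teq t s
| teq_trans s t u : teq s t -> teq t u -> teq s u
| teq_cat s s' t t' : teq s s' -> teq t t' -> teq (s ++ t) (s' ++ t')
| teq_catC s t : teq (s ++ t) (t ++ s)
| teq_addl m m' n : teq [:: (m + m', n)] [:: (m, n); (m', n)]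
| teq_addr m n n' : teq [:: (m, n + n')] [:: (m, n); (m, n')]
| teq_scale k m n : teq [:: (k *: m, n)] [:: (m, k *: n)]
| teq_zero n : teq [:: (0, n)] [::].

Definition teqb : rel (seq (M * N)) := fun s t => `[< teq s t >].

Lemma teqb_refl : reflexive teqb.
Proof. by move=> s; apply/asboolP; apply: teq_refl. Qed.
Lemma teqb_sym : symmetric teqb.
Proof. by move=> s t; apply/asboolP/asboolP; apply: teq_sym. Qed.
Lemma teqb_trans : transitive teqb.
Proof.
move=> t s u /asboolP st /asboolP tu.
by apply/asboolP; apply: teq_trans st tu.
Qed.

Definition teq_equiv : equiv_rel (seq (M * N)) :=
  EquivRel teqb teqb_refl teqb_sym teqb_trans.

Definition tensor : Type := {eq_quot teq_equiv}.
HB.instance Definition _ := Choice.on tensor.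
HB.instance Definition _ := Quotient.on tensor.

Definition tclass (s : seq (M * N)) : tensor := \pi_tensor s.

Lemma tclassP s t : tclass s = tclass t <-> teq s t.
Proof.
split=> [/eqmodP /asboolP//|st].
by apply/eqmodP/asboolP.
Qed.

Lemma tclass_repr (x : tensor) : tclass (repr x) = x.
Proof. exact: reprK. Qed.

Lemma repr_tclass s : teq (repr (tclass s)) s.
Proof. by apply/tclassP; rewrite tclass_repr. Qed.

Definition sc_seq (k : K) (s : seq (M * N)) := [seq (k *: x.1, x.2) | x <- s].

Definition tadd (x y : tensor) : tensor := tclass (repr x ++ repr y).
Definition tscale k (x : tensor) : tensor := tclass (sc_seq k (repr x)).
Definition tzero : tensor := tclass [::].
Definition topp := tscale (-1).

Lemma tadd_class s t : tadd (tclass s) (tclass t) = tclass (s ++ t).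
Proof. by apply/tclassP; apply: teq_cat; apply: repr_tclass. Qed.

Lemma sc_seq_teq k s t : teq s t -> teq (sc_seq k s) (sc_seq k t).
Proof.
elim=> {s t} /=.
- by move=> s; apply: teq_refl.
- by move=> s t _; apply: teq_sym.
- by move=> s t u _ st _; apply: teq_trans.
- by move=> s s' t t' _ ss' _ tt'; rewrite /sc_seq !map_cat; apply: teq_cat.
- by move=> s t; rewrite /sc_seq !map_cat; apply: teq_catC.
- by move=> m m' n; rewrite scalerDr; apply: teq_addl.
- by move=> m n n'; apply: teq_addr.
- move=> l m n; rewrite scalerA mulrC -scalerA; exact: teq_scale.
- by move=> n; rewrite scaler0; apply: teq_zero.
Qed.

Lemma tscale_class k s : tscale k (tclass s) = tclass (sc_seq k s).
Proof. by apply/tclassP; apply: sc_seq_teq; apply: repr_tclass. Qed.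

Lemma taddA : associative tadd.
Proof.
move=> x y z; rewrite -[x]tclass_repr -[y]tclass_repr -[z]tclass_repr.
by rewrite !tadd_class catA.
Qed.

Lemma taddC : commutative tadd.
Proof.
move=> x y; rewrite -[x]tclass_repr -[y]tclass_repr !tadd_class.
by apply/tclassP; apply: teq_catC.
Qed.

Lemma tadd0 : left_id tzero tadd.
Proof. by move=> x; rewrite -[x]tclass_repr tadd_class. Qed.

Lemma sc_seqDl k l s : teq (sc_seq (k + l) s) (sc_seq k s ++ sc_seq l s).
Proof.
elim: s => [|[m n] s IHs] /=; first exact: teq_refl.
rewrite scalerDl; set x := (k *: m, n); set y := (l *: m, n).
apply: (@teq_trans _ ([:: x; y] ++ (sc_seq k s ++ sc_seq l s))).
  exact: (teq_cat (teq_addl _ _ _) IHs).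
apply: (@teq_cat [:: x] [:: x] ([:: y] ++ sc_seq k s ++ sc_seq l s)
  (sc_seq k s ++ [:: y] ++ sc_seq l s)); first exact: teq_refl.
rewrite !catA; apply: teq_cat; [exact: teq_catC | exact: teq_refl].
Qed.

Lemma sc_seq0 s : teq (sc_seq 0 s) [::].
Proof.
elim: s => [|[m n] s IHs] /=; first exact: teq_refl.
rewrite scale0r -cat1s -[[::]]cats0; apply: teq_cat IHs; exact: teq_zero.
Qed.

Lemma sc_seq1 s : sc_seq 1 s = s.
Proof. by elim: s => //= -[m n] s ->; rewrite scale1r. Qed.

Lemma taddN : left_inverse tzero topp tadd.
Proof.
move=> x; rewrite -[x]tclass_repr /topp tscale_class tadd_class.
apply/tclassP; rewrite -{2}[repr x]sc_seq1.
apply: teq_trans (sc_seq0 (repr x)).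
by rewrite -(addNr 1); apply: teq_sym; apply: sc_seqDl.
Qed.

HB.instance Definition _ := GRing.isZmodule.Build tensor taddA taddC tadd0 taddN.

Lemma tscaleA k l (x : tensor) : tscale k (tscale l x) = tscale (k * l) x.
Proof.
rewrite -[x]tclass_repr !tscale_class /sc_seq -map_comp.
by congr tclass; apply: eq_map => -[m n] /=; rewrite scalerA.
Qed.

Lemma tscale1 : left_id 1 tscale.
Proof. by move=> x; rewrite -[x]tclass_repr tscale_class sc_seq1. Qed.

Lemma tscaleDr : right_distributive tscale +%R.
Proof.
move=> k x y; rewrite -[x]tclass_repr -[y]tclass_repr.
rewrite /GRing.add /= tadd_class !tscale_class tadd_class.
by rewrite /sc_seq map_cat.
Qed.

Lemma tscaleDl x : {morph tscale^~ x : k l / k + l}.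
Proof.
move=> k l; rewrite -[x]tclass_repr !tscale_class.
rewrite [RHS]tadd_class; apply/tclassP; exact: sc_seqDl.
Qed.

HB.instance Definition _ := GRing.Zmodule_isLmodule.Build K tensor
  tscaleA tscale1 tscaleDr tscaleDl.

Definition tens (m : M) (n : N) : tensor := tclass [:: (m, n)].

End TensorRel.

Notation "m ⊗ n" := (tens m n) (at level 40, left associativity) : ring_scope.

Definition bilin (K : comPzRingType) (M N P : lmodType K) (f : M -> N -> P) :=
  (forall n, linear (f^~ n)) /\ (forall m, linear (f m)).

(* [tsum f x] is Sweedler's f(x', x'') for x = x' (x) x'' (summation         *)
(* suppressed).  It is computed on a representative of x; when f is bilinear *)
(* it does not depend on it and x |-> tsum f x is the linear map induced by  *)
(* f, see tsum_tens and tsum_linear.                                         *)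
Definition tsum (K : comPzRingType) (M N P : lmodType K) (f : M -> N -> P)
  (x : tensor M N) : P := \sum_(y <- repr x) f y.1 y.2.

Section TensorTheory.
Variables (K : comPzRingType) (M N : lmodType K).

Lemma tens_bilin : bilin (@tens K M N).
Proof.
split=> [n k u v|m k u v].
  rewrite [RHS](_ : _ = tclass [:: (k *: u, n); (v, n)]); last first.
    by rewrite [_ *: _]tscale_class [LHS]tadd_class.
  by apply/tclassP; apply: teq_addl.
rewrite [RHS](_ : _ = tclass [:: (k *: m, u); (m, v)]); last first.
  by rewrite [_ *: _]tscale_class [LHS]tadd_class.
apply/tclassP; apply: teq_trans (teq_addr _ _ _) _.
rewrite -[[:: _; _]]cat1s -[X in teq _ X]cat1s.
by apply: teq_cat; [apply: teq_sym; apply: teq_scale | apply: teq_refl].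
Qed.

Lemma tclassE (s : seq (M * N)) : tclass s = \sum_(x <- s) x.1 ⊗ x.2.
Proof.
elim: s => [|[m n] s IHs]; first by rewrite big_nil.
by rewrite big_cons -IHs [RHS]tadd_class.
Qed.

Lemma tensor_repr (x : tensor M N) : x = \sum_(y <- repr x) y.1 ⊗ y.2.
Proof. by rewrite -tclassE tclass_repr. Qed.

Section Lift.
Variables (P : lmodType K) (f : M -> N -> P).
Hypothesis fP : bilin f.

Let f0l n : f 0 n = 0.
Proof. by have := fP.1 n (-1) 0 0; rewrite /= scaler0 addr0 scaleN1r addNr. Qed.

Lemma sum_teq s t : teq s t ->
  \sum_(y <- s) f y.1 y.2 = \sum_(y <- t) f y.1 y.2.
Proof.
elim=> {s t} //=.
- by move=> s t u _ -> _.
- by move=> s s' t t' _ ss' _ tt'; rewrite !big_cat /= ss' tt'.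
- by move=> s t; rewrite !big_cat /= addrC.
- move=> m m' n; rewrite !big_cons !big_nil /= !addr0.
  by have := fP.1 n 1 m m'; rewrite !scale1r.
- move=> m n n'; rewrite !big_cons !big_nil /= !addr0.
  by have := fP.2 m 1 n n'; rewrite !scale1r.
- move=> k m n; rewrite !big_cons !big_nil /= !addr0.
  have := fP.1 n k m 0; rewrite f0l !addr0 => ->.
  have f0r : f m 0 = 0.
    by have := fP.2 m (-1) 0 0; rewrite /= scaler0 addr0 scaleN1r addNr.
  by have := fP.2 m k n 0; rewrite f0r !addr0 => ->.
- by move=> n; rewrite big_cons !big_nil f0l addr0.
Qed.

Lemma tsum_class s : tsum f (tclass s) = \sum_(y <- s) f y.1 y.2.
Proof. by apply: sum_teq; apply: repr_tclass. Qed.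

Lemma tsum_tens m n : tsum f (m ⊗ n) = f m n.
Proof. by rewrite tsum_class big_seq1. Qed.

Lemma tsum_linear : linear (tsum f).
Proof.
move=> k x y; rewrite -[x]tclass_repr -[y]tclass_repr.
rewrite [_ *: _]tscale_class [X in tsum _ X]tadd_class !tsum_class big_cat /=.
rewrite big_map scaler_sumr; congr (_ + _); apply: eq_bigr => -[m n] _ /=.
by have := fP.1 n k m 0; rewrite f0l !addr0.
Qed.

End Lift.

Lemma tensor_ext (P : lmodType K) (g h : tensor M N -> P) :
  linear g -> linear h -> (forall m n, g (m ⊗ n) = h (m ⊗ n)) -> g =1 h.
Proof.
move=> gl hl gh x; rewrite [x]tensor_repr.
have L0 (F : tensor M N -> P) : linear F -> F 0 = 0.
  by move=> Fl; have := Fl (-1) 0 0; rewrite scaler0 addr0 scaleN1r addNr.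
elim: (repr x) => [|y s IHs]; first by rewrite !big_nil !L0.
rewrite !big_cons; have := gl 1 (y.1 ⊗ y.2); have := hl 1 (y.1 ⊗ y.2).
by rewrite !scale1r => -> ->; rewrite gh IHs.
Qed.

End TensorTheory.

HB.mixin Record Lmodule_isNuAlg (K : comPzRingType) A of GRing.Lmodule K A := {
  amul : A -> A -> A;
  amulA : associative amul;
  amul_bilin : bilin amul;
}.

(* associative, not necessarily unital *)
#[short(type="nuAlgType")]
HB.structure Definition NuAlg (K : comPzRingType) :=
  {A of GRing.Lmodule K A & Lmodule_isNuAlg K A}.

Notation "a ⋅ b" := (amul a b) (at level 40, left associativity) : ring_scope.

(* A is the internal direct sum of the submodules [homog p], p : int. *)
HB.mixin Record NuAlg_isGraded (K : comPzRingType) A of NuAlg K A := {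
  homog : int -> A -> Prop;
  homog0 : forall p, homog p 0;
  homogP : forall p k a b, homog p a -> homog p b -> homog p (k *: a + b);
  homogM : forall p q a b, homog p a -> homog q b -> homog (p + q) (a ⋅ b);
  homog_span : forall a, exists (s : seq int) (x : int -> A),
    [/\ uniq s, forall p, homog p (x p) & a = \sum_(p <- s) x p];
  homog_indep : forall (s : seq int) (x : int -> A), uniq s ->
    (forall p, homog p (x p)) -> \sum_(p <- s) x p = 0 ->
    forall p, p \in s -> x p = 0;
}.

#[short(type="gradedAlgType")]
HB.structure Definition GradedAlg (K : comPzRingType) :=
  {A of NuAlg K A & NuAlg_isGraded K A}.

(* In [comulA] both sides lie in (M (x) M) (x) M. *)
HB.mixin Record Lmodule_isCoalg (K : comPzRingType) M of GRing.Lmodule K M := {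
  comul : {linear M -> tensor M M};
  comulA : forall x : M,
    tsum (fun y z => comul y ⊗ z) (comul x) =
    tsum (fun y z => tsum (fun z1 z2 => (y ⊗ z1) ⊗ z2) (comul z)) (comul x);
}.

#[short(type="coalgType")]
HB.structure Definition Coalg (K : comPzRingType) :=
  {M of GRing.Lmodule K M & Lmodule_isCoalg K M}.

HB.mixin Record Coalg_isCounital (K : comPzRingType) M of Coalg K M := {
  counit : {linear M -> K^o};
  counitl : forall x : M, tsum (fun y z => (counit y : K) *: z) (comul x) = x;
  counitr : forall x : M, tsum (fun y z => (counit z : K) *: y) (comul x) = x;
}.

#[short(type="counitalCoalgType")]
HB.structure Definition CounitalCoalg (K : comPzRingType) :=
  {M of Coalg K M & Coalg_isCounital K M}.

Section Sweedler.
Variables (K : comPzRingType).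

Lemma lin_sum (V W : lmodType K) (h : V -> W) : linear h ->
  forall I (r : seq I) (F : I -> V), h (\sum_(i <- r) F i) = \sum_(i <- r) h (F i).
Proof.
move=> hl I r F.
have h0 : h 0 = 0.
  by have := hl (-1) 0 0; rewrite scaler0 addr0 scaleN1r addNr.
elim: r => [|i r IHr]; first by rewrite !big_nil.
rewrite !big_cons -IHr.
by have := hl 1 (F i) (\sum_(j <- r) F j); rewrite !scale1r.
Qed.

Lemma linD (V W : lmodType K) (h : V -> W) u v : linear h ->
  h (u + v) = h u + h v.
Proof. by move=> hl; have := hl 1 u v; rewrite !scale1r. Qed.

Lemma linZ (V W : lmodType K) (h : V -> W) k u : linear h ->
  h (k *: u) = k *: h u.
Proof.
move=> hl; have := hl k u 0.
have := hl (-1) 0 0; rewrite scaler0 addr0 scaleN1r addNr => ->.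
by rewrite !addr0.
Qed.

Lemma linB (V W : lmodType K) (h : V -> W) u v : linear h ->
  h (u - v) = h u - h v.
Proof. by move=> hl; rewrite (linD _ _ hl) -scaleN1r (linZ _ _ hl) scaleN1r. Qed.

Lemma linear_sub (V W : lmodType K) (g h : V -> W) : linear g -> linear h ->
  linear (fun u => g u - h u).
Proof.
by move=> gl hl k u v; rewrite gl hl scalerBr opprD addrACA.
Qed.

Lemma linear_add (V W : lmodType K) (g h : V -> W) : linear g -> linear h ->
  linear (fun u => g u + h u).
Proof. by move=> gl hl k u v; rewrite gl hl scalerDr addrACA. Qed.

Lemma lin_tsum (M N V W : lmodType K) (h : V -> W) (f : M -> N -> V) x :
  linear h -> h (tsum f x) = tsum (fun m n => h (f m n)) x.
Proof. by move=> hl; rewrite /tsum lin_sum. Qed.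

Lemma eq_tsum (M N V : lmodType K) (f g : M -> N -> V) x :
  (forall m n, f m n = g m n) -> tsum f x = tsum g x.
Proof. by move=> fg; apply: eq_bigr. Qed.

Lemma tsumD (M N V : lmodType K) (f g : M -> N -> V) x :
  tsum (fun m n => f m n + g m n) x = tsum f x + tsum g x.
Proof. exact: big_split. Qed.

Lemma tsumN (M N V : lmodType K) (f : M -> N -> V) x :
  tsum (fun m n => - f m n) x = - tsum f x.
Proof. exact: sumrN. Qed.

Lemma tsumB (M N V : lmodType K) (f g : M -> N -> V) x :
  tsum (fun m n => f m n - g m n) x = tsum f x - tsum g x.
Proof. by rewrite tsumD tsumN. Qed.

Lemma tsum_plin (M N V W : lmodType K) (F : W -> M -> N -> V) x :
  (forall m n, linear (fun w => F w m n)) -> linear (fun w => tsum (F w) x).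
Proof.
move=> Fl k u v; rewrite /tsum scaler_sumr -big_split.
by apply: eq_bigr => y _; apply: Fl.
Qed.

Lemma linear_comp (U V W : lmodType K) (g : V -> W) (f : U -> V) :
  linear g -> linear f -> linear (fun u => g (f u)).
Proof. by move=> gl fl k u v; rewrite fl gl. Qed.

Lemma linear_sc (U V : lmodType K) (f : U -> K^o) (v : V) :
  linear f -> linear (fun u => (f u : K) *: v).
Proof.
by move=> fl k u w; rewrite fl scalerDl scalerA.
Qed.

Lemma linear_scr (U V : lmodType K) (f : U -> V) (c : K) :
  linear f -> linear (fun u => c *: f u).
Proof.
by move=> fl k u w; rewrite fl scalerDr !scalerA mulrC.
Qed.

Lemma linear_tensl (U M N : lmodType K) (f : U -> M) (n : N) :
  linear f -> linear (fun u => f u ⊗ n).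
Proof. by move=> fl k u v; rewrite fl; apply: (tens_bilin M N).1. Qed.

Lemma linear_tensr (U M N : lmodType K) (f : U -> N) (m : M) :
  linear f -> linear (fun u => m ⊗ f u).
Proof. by move=> fl k u v; rewrite fl; apply: (tens_bilin M N).2. Qed.

Lemma linear_idfun (U : lmodType K) : linear (fun u : U => u).
Proof. by []. Qed.

End Sweedler.

(* [tsum3 g x] is g(x', x'', x''') for x = x' (x) x'' (x) x'''. *)
Definition tsum3 (K : comPzRingType) (L M N P : lmodType K)
  (g : L -> M -> N -> P) (x : tensor (tensor L M) N) : P :=
  tsum (fun y n => tsum (fun l m => g l m n) y) x.

Definition trilin (K : comPzRingType) (L M N P : lmodType K)
  (g : L -> M -> N -> P) :=
  [/\ forall m n, linear (fun l => g l m n), forall l n, linear (fun m => g l m n)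
    & forall l m, linear (g l m)].

Section CoalgTheory.
Variables (K : comPzRingType) (M : coalgType K).

(* alpha |-> alpha^1 (x) alpha^2 (x) alpha^3 *)
Definition comul3 (x : M) : tensor (tensor M M) M :=
  tsum (fun y z => comul y ⊗ z) (comul x).

Lemma coassoc (V : lmodType K) (g : M -> M -> M -> V) (x : M) : trilin g ->
  tsum (fun y z => tsum (fun y1 y2 => g y1 y2 z) (comul y)) (comul x) =
  tsum (fun y z => tsum (fun z1 z2 => g y z1 z2) (comul z)) (comul x).
Proof.
case=> g1 g2 g3.
have bl n : bilin (fun l m => g l m n).
  by split=> [m|l]; [apply: g1 | apply: g2].
have b3 : bilin (fun (y : tensor M M) n => tsum (fun l m => g l m n) y).
  split=> [n|y]; first exact: tsum_linear.
  by apply: tsum_plin.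
have := congr1 (tsum3 g) (comulA x); rewrite /tsum3.
rewrite !(lin_tsum _ _ (tsum_linear b3)).
under eq_tsum => y z do rewrite tsum_tens//.
move=> ->; apply: eq_tsum => y z.
rewrite (lin_tsum _ _ (tsum_linear b3)); apply: eq_tsum => z1 z2.
by rewrite !tsum_tens.
Qed.

Definition deltaM (phi : {linear M -> K^o}) (x : M) : M :=
  tsum (fun y z => (phi z : K) *: y - (phi y : K) *: z) (comul x).

Lemma deltaM_bilin (phi : {linear M -> K^o}) :
  bilin (fun y z : M => (phi z : K) *: y - (phi y : K) *: z).
Proof.
have pl : linear (phi : M -> K^o) by exact: linearP.
split=> *; apply: linear_sub; by [apply: linear_scr | apply: linear_sc].
Qed.

Lemma deltaM_linear phi : linear (deltaM phi).
Proof.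
by move=> k u v; rewrite /deltaM linearP (tsum_linear (deltaM_bilin phi)).
Qed.

Lemma deltaM_coder phi (x : M) : comul (deltaM phi x) =
  tsum (fun y z => deltaM phi y ⊗ z + y ⊗ deltaM phi z) (comul x).
Proof.
have cl : linear (@comul K M) by move=> k u v; rewrite linearP.
have pl : linear (phi : M -> K^o) by exact: linearP.
have il := @linear_idfun K M.
pose g1 (a b c : M) : tensor M M := (phi c : K) *: (a ⊗ b).
pose g2 (a b c : M) : tensor M M := (phi a : K) *: (b ⊗ c).
pose g3 (a b c : M) : tensor M M := (phi b : K) *: (a ⊗ c).
have t1 : trilin g1.
  by split=> ? ?; [apply/linear_scr/linear_tensl|apply/linear_scr/linear_tensr
    |apply: linear_sc].
have t2 : trilin g2.
  by split=> ? ?; [apply: linear_sc|apply/linear_scr/linear_tensl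
    |apply/linear_scr/linear_tensr].
have t3 : trilin g3.
  by split=> ? ?; [apply/linear_scr/linear_tensl|apply: linear_sc
    |apply/linear_scr/linear_tensr].
rewrite {1}/deltaM lin_tsum //.
transitivity (tsum (fun y z => tsum (fun z1 z2 => g1 y z1 z2) (comul z)) (comul x)
  - tsum (fun y z => tsum (fun y1 y2 => g2 y1 y2 z) (comul y)) (comul x)).
  rewrite -(coassoc _ t1) (coassoc _ t2) -tsumB; apply: eq_tsum => y z.
  have E (k : K) (t : tensor M M) : k *: t = tsum (fun a b => k *: (a ⊗ b)) t.
    by rewrite /tsum -scaler_sumr -tensor_repr.
  by rewrite (linB _ _ cl) !(linZ _ _ cl) !E.
rewrite tsumD.
have -> : tsum (fun y z => deltaM phi y ⊗ z) (comul x) =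
    tsum (fun y z => tsum (fun y1 y2 => g3 y1 y2 z) (comul y)) (comul x)
  - tsum (fun y z => tsum (fun y1 y2 => g2 y1 y2 z) (comul y)) (comul x).
  rewrite -tsumB; apply: eq_tsum => y z.
  rewrite /deltaM (lin_tsum _ _ (linear_tensl z il)) -tsumB.
  apply: eq_tsum => y1 y2; have lz := linear_tensl z il.
  by rewrite (linB _ _ lz) !(linZ _ _ lz).
have -> : tsum (fun y z => y ⊗ deltaM phi z) (comul x) =
    tsum (fun y z => tsum (fun z1 z2 => g1 y z1 z2) (comul z)) (comul x)
  - tsum (fun y z => tsum (fun z1 z2 => g3 y z1 z2) (comul z)) (comul x).
  rewrite -tsumB; apply: eq_tsum => y z.
  rewrite /deltaM (lin_tsum _ _ (linear_tensr y il)) -tsumB.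
  apply: eq_tsum => z1 z2; have lz := linear_tensr y il.
  by rewrite (linB _ _ lz) !(linZ _ _ lz).
by rewrite (coassoc _ t3) [RHS]addrC subrKA.
Qed.

End CoalgTheory.

(* The dual algebra M^* (convolution product) and the bracket of the Lie      *)
(* algebra with the same underlying module.                                   *)
Section Dual.
Variables (K : comPzRingType) (M : coalgType K).
Implicit Types phi psi : {linear M -> K^o}.

Definition dual_mul_fun phi psi (x : M) : K^o :=
  tsum (fun y z => ((phi y : K) * (psi z : K) : K^o)) (comul x).

Lemma dual_mul_linear phi psi : linear (dual_mul_fun phi psi).
Proof.
have pl : linear (phi : M -> K^o) by exact: linearP.
have ql : linear (psi : M -> K^o) by exact: linearP.
move=> k u v; rewrite /dual_mul_fun linearP.
rewrite [LHS](tsum_linear (P := K^o))//; split=> w.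
  by move=> l a b; rewrite pl mulrDl; congr (_ + _); rewrite -mulrA.
move=> l a b; rewrite ql mulrDr; congr (_ + _).
by rewrite [LHS]mulrCA.
Qed.
HB.instance Definition _ phi psi :=
  GRing.isLinear.Build K M K^o _ (dual_mul_fun phi psi) (dual_mul_linear phi psi).
Definition dual_mul phi psi : {linear M -> K^o} := dual_mul_fun phi psi.

Definition dual_bracket_fun phi psi (x : M) : K^o :=
  dual_mul phi psi x - dual_mul psi phi x.
Lemma dual_bracket_linear phi psi : linear (dual_bracket_fun phi psi).
Proof. by apply: linear_sub; exact: linearP. Qed.
HB.instance Definition _ phi psi :=
  GRing.isLinear.Build K M K^o _ (dual_bracket_fun phi psi)
    (dual_bracket_linear phi psi).
Definition dual_bracket phi psi : {linear M -> K^o} := dual_bracket_fun phi psi.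

Lemma deltaM_bracket phi psi (x : M) :
  deltaM (dual_bracket phi psi) x =
  deltaM phi (deltaM psi x) - deltaM psi (deltaM phi x).
Proof.
have il := @linear_idfun K M.
have pl : linear (phi : M -> K^o) by exact: linearP.
have ql : linear (psi : M -> K^o) by exact: linearP.
pose g1 (a b c : M) : M := (phi b : K) *: ((psi c : K) *: a).
pose g2 (a b c : M) : M := (psi b : K) *: ((phi c : K) *: a).
pose h1 (a b c : M) : M := (phi a : K) *: ((psi b : K) *: c).
pose h2 (a b c : M) : M := (psi a : K) *: ((phi b : K) *: c).
pose m1 (a b c : M) : M := (phi a : K) *: ((psi c : K) *: b).
pose m2 (a b c : M) : M := (psi a : K) *: ((phi c : K) *: b).
have tg1 : trilin g1.
  split=> ? ?; [exact/linear_scr/linear_scr|exact: linear_sc|].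
  exact/linear_scr/linear_sc.
have tg2 : trilin g2.
  split=> ? ?; [exact/linear_scr/linear_scr|exact: linear_sc|].
  exact/linear_scr/linear_sc.
have th1 : trilin h1.
  split=> ? ?; [exact: linear_sc|exact/linear_scr/linear_sc|].
  exact/linear_scr/linear_scr.
have th2 : trilin h2.
  split=> ? ?; [exact: linear_sc|exact/linear_scr/linear_sc|].
  exact/linear_scr/linear_scr.
have tm1 : trilin m1.
  split=> ? ?; [exact: linear_sc|exact/linear_scr/linear_scr|].
  exact/linear_scr/linear_sc.
have tm2 : trilin m2.
  split=> ? ?; [exact: linear_sc|exact/linear_scr/linear_scr|].
  exact/linear_scr/linear_sc.
pose R (g : M -> M -> M -> M) :=
  tsum (fun y z => tsum (fun z1 z2 => g y z1 z2) (comul z)) (comul x).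
have scE (f : M -> M -> K^o) (t : tensor M M) (a : M) :
    (tsum f t : K) *: a = tsum (fun b c => (f b c : K) *: a) t.
  by rewrite /tsum scaler_suml.
have scV (f : M -> M -> M) (t : tensor M M) (k : K) :
    k *: tsum f t = tsum (fun b c => k *: f b c) t.
  by rewrite /tsum scaler_sumr.
have E (f g : {linear M -> K^o}) (G H1 H2 : M -> M -> M -> M) :
    (forall a b c, G a b c = (f b : K) *: ((g c : K) *: a)) ->
    (forall a b c, H1 a b c = (f a : K) *: ((g c : K) *: b)) ->
    (forall a b c, H2 a b c = (g a : K) *: ((f c : K) *: b)) ->
    trilin G -> trilin H1 ->
    deltaM f (deltaM g x) = R G - R H1 - R H2
      + R (fun a b c => (g a : K) *: ((f b : K) *: c)).
  move=> EG EH1 EH2 tG tH1.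
  pose L (g : M -> M -> M -> M) :=
    tsum (fun y z => tsum (fun y1 y2 => g y1 y2 z) (comul y)) (comul x).
  pose H3 (a b c : M) : M := (g a : K) *: ((f b : K) *: c).
  transitivity (L G - L H1 - (R H2 - R H3)); last first.
    by rewrite /L (coassoc _ tG) (coassoc _ tH1) opprB addrA addrAC.
  rewrite {2}/deltaM (lin_tsum _ _ (deltaM_linear f)).
  rewrite /L /R -!tsumB; apply: eq_tsum => y z.
  rewrite (linB _ _ (deltaM_linear f)) !(linZ _ _ (deltaM_linear f)).
  rewrite /deltaM !scV -!tsumB; congr (_ - _); apply: eq_tsum => a b.
    by rewrite EG EH1 scalerBr !scalerA ![_ * (g z : K)]mulrC.
  by rewrite EH2 scalerBr.
rewrite (E phi psi g1 m1 m2)// (E psi phi g2 m2 m1)//.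
have -> : deltaM (dual_bracket phi psi) x =
    R g1 - R g2 - (R h1 - R h2).
  rewrite /R -(coassoc _ th1) -(coassoc _ th2) -!tsumB.
  apply: eq_tsum => y z; rewrite -!tsumB.
  have bE (w : M) (a : M) : (dual_bracket phi psi w : K) *: a =
      tsum (fun b c => (phi b : K) *: ((psi c : K) *: a)) (comul w)
    - tsum (fun b c => (psi b : K) *: ((phi c : K) *: a)) (comul w).
    rewrite -[X in X *: _]/((dual_mul_fun phi psi w : K) - dual_mul_fun psi phi w).
    rewrite scalerBl !scE; congr (_ - _); apply: eq_tsum => b c;
      by rewrite scalerA.
  by rewrite !bE -!tsumB.
rewrite (_ : R (fun a b c => (psi a : K) *: ((phi b : K) *: c)) = R h2)//.
rewrite (_ : R (fun a b c => (phi a : K) *: ((psi b : K) *: c)) = R h1)//.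
rewrite !opprD !opprK.
by rewrite [RHS](AC (4*4) (1*5*(8*4)*(2*7)*(3*6))) /= !addNr !addr0.
Qed.

End Dual.

Definition isign (K : comPzRingType) (m : int) : K := (-1) ^+ `|m|%N.

Lemma lin_sum_cond (K : comPzRingType) (V W : lmodType K) (h : V -> W) : linear h ->
  forall I (r : seq I) (P : pred I) (F : I -> V),
  h (\sum_(i <- r | P i) F i) = \sum_(i <- r | P i) h (F i).
Proof. by move=> hl I r P F; rewrite -big_filter (lin_sum hl) big_filter. Qed.

Section Grading.
Variables (K : comPzRingType) (A : gradedAlgType K).

Lemma homogZ p (k : K) (a : A) : homog p a -> homog p (k *: a).
Proof. by move=> ha; rewrite -[_ *: _]addr0; apply: homogP ha (homog0 _). Qed.
Lemma homogD p (a b : A) : homog p a -> homog p b -> homog p (a + b).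
Proof. by move=> ha hb; rewrite -[a]scale1r; apply: homogP. Qed.
Lemma homogB p (a b : A) : homog p a -> homog p b -> homog p (a - b).
Proof. by move=> ha hb; rewrite -scaleN1r addrC; apply: homogP. Qed.

(* finitely many degrees, containing all those of the components of [a] *)
Definition hsupp (a : A) : seq int := sval (cid (homog_span a)).

(* the component of degree [p] of [a] *)
Definition hcomp (p : int) (a : A) : A :=
  if p \in hsupp a then sval (cid (svalP (cid (homog_span a)))) p else 0.

Lemma hsupp_uniq a : uniq (hsupp a).
Proof. by rewrite /hsupp; case: (cid (homog_span a)) => s /= [x []]. Qed.

Lemma hcomp_homog p a : homog p (hcomp p a).
Proof.
rewrite /hcomp; case: ifP => _; last exact: homog0.
by case: (cid (svalP (cid (homog_span a)))) => x /= [].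
Qed.

Lemma hcomp_out p a : p \notin hsupp a -> hcomp p a = 0.
Proof. by rewrite /hcomp => /negPf ->. Qed.

Lemma hcomp_sum a : a = \sum_(p <- hsupp a) hcomp p a.
Proof.
rewrite (eq_big_seq (sval (cid (svalP (cid (homog_span a)))))).
  by case: (cid (svalP (cid (homog_span a)))) => x /= [].
by move=> p pa; rewrite /hcomp pa.
Qed.

Lemma sum_widen (V : zmodType) (s t : seq int) (F : int -> V) :
  uniq s -> uniq t -> {subset s <= t} -> (forall p, p \notin s -> F p = 0) ->
  \sum_(p <- t) F p = \sum_(p <- s) F p.
Proof.
move=> us ut st F0; rewrite (bigID (mem s)) /= [X in _ + X]big1 ?addr0//.
rewrite -big_filter; apply: perm_big; apply: uniq_perm; rewrite ?filter_uniq//.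
by move=> p; rewrite mem_filter; case: (boolP (p \in s)) => // /st ->.
Qed.

Lemma hcompE (s : seq int) (x : int -> A) a p : uniq s ->
  (forall q, homog q (x q)) -> a = \sum_(q <- s) x q ->
  hcomp p a = if p \in s then x p else 0.
Proof.
move=> us xh aE.
pose y q := hcomp q a - (if q \in s then x q else 0).
pose t := undup (p :: s ++ hsupp a).
have ut : uniq t by rewrite undup_uniq.
apply/eqP; rewrite -subr_eq0; apply/eqP; apply: (@homog_indep K A t y ut).
- by move=> q; apply: homogB; [apply: hcomp_homog|case: ifP => // _; apply: homog0].
- rewrite /y sumrB.
  rewrite (sum_widen (hsupp_uniq a) ut) -?hcomp_sum; last 1 first.
  + by move=> q; apply: hcomp_out.
  + rewrite (sum_widen us ut); last 1 first.
    * by move=> q /negPf ->.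
    * rewrite [X in _ - X](eq_big_seq x) -?aE ?subrr// => q qs.
      by rewrite qs.
    by move=> q qs; rewrite mem_undup inE mem_cat qs orbT.
  by move=> q qs; rewrite mem_undup inE mem_cat qs !orbT.
- by rewrite mem_undup inE eqxx.
Qed.

Lemma hcomp_id p q a : homog q a -> hcomp p a = if p == q then a else 0.
Proof.
move=> ha; rewrite (@hcompE [:: q] (fun r => if r == q then a else 0))//.
- by rewrite inE; case: eqP.
- by move=> r; case: eqP => [->|_] //; apply: homog0.
- by rewrite big_seq1 eqxx.
Qed.

Lemma hcomp_linear p : linear (hcomp p : A -> A).
Proof.
move=> k a b; pose t := undup (hsupp a ++ hsupp b).
have ut : uniq t by rewrite undup_uniq.
have hE c : {subset hsupp c <= t} -> c = \sum_(q <- t) hcomp q c.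
  move=> ct; rewrite (sum_widen (hsupp_uniq c) ut ct) -?hcomp_sum//.
  by move=> q; apply: hcomp_out.
rewrite (@hcompE t (fun q => k *: hcomp q a + hcomp q b))//.
- case: ifP => // /negbT; rewrite mem_undup mem_cat negb_or.
  by case/andP => /hcomp_out -> /hcomp_out ->; rewrite scaler0 addr0.
- by move=> q; apply: homogP; apply: hcomp_homog.
- rewrite big_split -scaler_sumr /= -!hE// => q qs;
    by rewrite mem_undup mem_cat qs ?orbT.
Qed.

(* The linear map sending each homogeneous [a] of degree [p] to [f p a], when *)
(* the maps [f p] are linear.                                                 *)
Definition gext (V : lmodType K) (f : int -> A -> V) (a : A) : V :=
  \sum_(p <- hsupp a) f p (hcomp p a).

Section Gext.
Variables (V : lmodType K) (f : int -> A -> V).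
Hypothesis fl : forall p, linear (f p).

Lemma gext_sum (s : seq int) a : uniq s -> {subset hsupp a <= s} ->
  gext f a = \sum_(p <- s) f p (hcomp p a).
Proof.
move=> us as_; rewrite (sum_widen (hsupp_uniq a) us as_)// => p /hcomp_out ->.
by have := linB 0 0 (fl p); rewrite !subr0 subrr.
Qed.

Lemma gext_homog p a : homog p a -> gext f a = f p a.
Proof.
move=> ha; rewrite (@gext_sum (undup (p :: hsupp a))) ?undup_uniq//; last first.
  by move=> q qa; rewrite mem_undup inE qa orbT.
rewrite (@sum_widen _ [:: p]) ?undup_uniq//.
- by rewrite big_seq1 (hcomp_id _ ha) eqxx.
- by move=> q; rewrite mem_undup !inE => ->.
- move=> q; rewrite inE (hcomp_id _ ha) => /negPf ->.
  by have := linB 0 0 (fl q); rewrite !subr0 subrr.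
Qed.

Lemma gext_linear : linear (gext f).
Proof.
move=> k a b; pose t := undup (hsupp (k *: a + b) ++ hsupp a ++ hsupp b).
have ut : uniq t by rewrite undup_uniq.
rewrite !(@gext_sum t)//;
  try by move=> q qs; rewrite mem_undup !mem_cat qs ?orbT.
rewrite scaler_sumr -big_split; apply: eq_bigr => p _ /=.
by rewrite hcomp_linear fl.
Qed.

End Gext.

End Grading.

Section RepAlg.
Variables (K : comPzRingType) (A : gradedAlgType K) (M : coalgType K).

Inductive amterm : Type :=
| AGen of A & M
| AZero
| AAdd of amterm & amterm
| AScale of K & amterm
| AMul of amterm & amterm.

Definition asum (ts : seq amterm) : amterm := foldr AAdd AZero ts.

(* The congruence generated by the axioms of an associative K-algebra         *)
(* together with the defining relations of A_M; in [ameq_gen_mul] the list    *)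
(* [s] runs over all the expressions of the comultiplication of [al].         *)
Inductive ameq : amterm -> amterm -> Prop :=
| ameq_refl t : ameq t t
| ameq_sym t u : ameq t u -> ameq u t
| ameq_trans t u w : ameq t u -> ameq u w -> ameq t w
| ameq_add t t' u u' : ameq t t' -> ameq u u' -> ameq (AAdd t u) (AAdd t' u')
| ameq_scale k t t' : ameq t t' -> ameq (AScale k t) (AScale k t')
| ameq_mul t t' u u' : ameq t t' -> ameq u u' -> ameq (AMul t u) (AMul t' u')
| ameq_addA t u w : ameq (AAdd t (AAdd u w)) (AAdd (AAdd t u) w)
| ameq_addC t u : ameq (AAdd t u) (AAdd u t)
| ameq_add0 t : ameq (AAdd AZero t) t
| ameq_scaleA k l t : ameq (AScale k (AScale l t)) (AScale (k * l) t)
| ameq_scale1 t : ameq (AScale 1 t) t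
| ameq_scale0 t : ameq (AScale 0 t) AZero
| ameq_scaleDr k t u : ameq (AScale k (AAdd t u)) (AAdd (AScale k t) (AScale k u))
| ameq_scaleDl k l t : ameq (AScale (k + l) t) (AAdd (AScale k t) (AScale l t))
| ameq_mulA t u w : ameq (AMul t (AMul u w)) (AMul (AMul t u) w)
| ameq_mulDl t u w : ameq (AMul (AAdd t u) w) (AAdd (AMul t w) (AMul u w))
| ameq_mulDr t u w : ameq (AMul t (AAdd u w)) (AAdd (AMul t u) (AMul t w))
| ameq_mulZl k t u : ameq (AMul (AScale k t) u) (AScale k (AMul t u))
| ameq_mulZr k t u : ameq (AMul t (AScale k u)) (AScale k (AMul t u))
| ameq_genl k a b al :
    ameq (AGen (k *: a + b) al) (AAdd (AScale k (AGen a al)) (AGen b al))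
| ameq_genr k a al be :
    ameq (AGen a (k *: al + be)) (AAdd (AScale k (AGen a al)) (AGen a be))
| ameq_gen_mul a b al (s : seq (M * M)) :
    comul al = \sum_(x <- s) x.1 ⊗ x.2 ->
    ameq (AGen (a ⋅ b) al) (asum [seq AMul (AGen a x.1) (AGen b x.2) | x <- s])
| ameq_gen_comm p q a b al be : homog p a -> homog q b ->
    ameq (AMul (AGen a al) (AGen b be))
         (AScale (isign K (p * q)) (AMul (AGen b be) (AGen a al))).

HB.instance Definition _ := gen_eqMixin amterm.
HB.instance Definition _ := gen_choiceMixin amterm.

Definition ameqb : rel amterm := fun t u => `[< ameq t u >].

Lemma ameqb_refl : reflexive ameqb.
Proof. by move=> t; apply/asboolP; apply: ameq_refl. Qed.
Lemma ameqb_sym : symmetric ameqb.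
Proof. by move=> t u; apply/asboolP/asboolP; apply: ameq_sym. Qed.
Lemma ameqb_trans : transitive ameqb.
Proof.
move=> u t w /asboolP tu /asboolP uw.
by apply/asboolP; apply: ameq_trans tu uw.
Qed.

Definition ameq_equiv : equiv_rel amterm :=
  EquivRel ameqb ameqb_refl ameqb_sym ameqb_trans.

Definition repalg : Type := {eq_quot ameq_equiv}.
HB.instance Definition _ := Choice.on repalg.
HB.instance Definition _ := Quotient.on repalg.

Definition aclass (t : amterm) : repalg := \pi_repalg t.

Lemma aclassP t u : aclass t = aclass u <-> ameq t u.
Proof.
split=> [/eqmodP /asboolP//|tu].
by apply/eqmodP/asboolP.
Qed.

Lemma aclass_repr (x : repalg) : aclass (repr x) = x.
Proof. exact: reprK. Qed.

Lemma repr_aclass t : ameq (repr (aclass t)) t.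
Proof. by apply/aclassP; rewrite aclass_repr. Qed.

Definition repalg_add (x y : repalg) := aclass (AAdd (repr x) (repr y)).
Definition repalg_scale k (x : repalg) := aclass (AScale k (repr x)).
Definition repalg_mul (x y : repalg) := aclass (AMul (repr x) (repr y)).
Definition repalg_zero := aclass AZero.
Definition repalg_opp := repalg_scale (-1).

Lemma aaddE t u : repalg_add (aclass t) (aclass u) = aclass (AAdd t u).
Proof. by apply/aclassP; apply: ameq_add; apply: repr_aclass. Qed.
Lemma ascaleE k t : repalg_scale k (aclass t) = aclass (AScale k t).
Proof. by apply/aclassP; apply: ameq_scale; apply: repr_aclass. Qed.
Lemma amulE t u : repalg_mul (aclass t) (aclass u) = aclass (AMul t u).
Proof. by apply/aclassP; apply: ameq_mul; apply: repr_aclass. Qed.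

Lemma aaddA : associative repalg_add.
Proof.
move=> x y z; rewrite -[x]aclass_repr -[y]aclass_repr -[z]aclass_repr !aaddE.
by apply/aclassP; apply: ameq_addA.
Qed.
Lemma aaddC : commutative repalg_add.
Proof. by move=> x y; apply/aclassP; apply: ameq_addC. Qed.
Lemma aadd0 : left_id repalg_zero repalg_add.
Proof.
by move=> x; rewrite -[x]aclass_repr aaddE; apply/aclassP; apply: ameq_add0.
Qed.
Lemma aaddN : left_inverse repalg_zero repalg_opp repalg_add.
Proof.
move=> x; rewrite -[x]aclass_repr /repalg_opp ascaleE aaddE; apply/aclassP.
set t := repr x; apply: ameq_trans (ameq_scale0 t).
rewrite -(addNr 1); apply: ameq_sym; apply: ameq_trans (ameq_scaleDl _ _ _) _.
by apply: ameq_add; [apply: ameq_refl | apply: ameq_scale1].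
Qed.
HB.instance Definition _ := GRing.isZmodule.Build repalg aaddA aaddC aadd0 aaddN.

Lemma ascaleA k l x : repalg_scale k (repalg_scale l x) = repalg_scale (k * l) x.
Proof.
by rewrite -[x]aclass_repr !ascaleE; apply/aclassP; apply: ameq_scaleA.
Qed.
Lemma ascale1 : left_id 1 repalg_scale.
Proof.
by move=> x; rewrite -[x]aclass_repr ascaleE; apply/aclassP; apply: ameq_scale1.
Qed.
Lemma ascaleDr : right_distributive repalg_scale +%R.
Proof.
move=> k x y; rewrite -[x]aclass_repr -[y]aclass_repr.
rewrite [X in repalg_scale k X]aaddE !ascaleE [RHS]aaddE.
by apply/aclassP; apply: ameq_scaleDr.
Qed.
Lemma ascaleDl x : {morph repalg_scale^~ x : k l / k + l}.
Proof.
move=> k l; rewrite -[x]aclass_repr !ascaleE [RHS]aaddE.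
by apply/aclassP; apply: ameq_scaleDl.
Qed.
HB.instance Definition _ := GRing.Zmodule_isLmodule.Build K repalg
  ascaleA ascale1 ascaleDr ascaleDl.

Lemma aclassD t u : aclass (AAdd t u) = aclass t + aclass u.
Proof. by rewrite -aaddE. Qed.
Lemma aclassZ k t : aclass (AScale k t) = k *: aclass t.
Proof. by rewrite -ascaleE. Qed.
Lemma aclass_sum (ts : seq amterm) :
  aclass (asum ts) = \sum_(t <- ts) aclass t.
Proof.
by elim: ts => [|t ts IHts]; rewrite ?big_nil// big_cons -IHts -aclassD.
Qed.

Lemma repalg_mulA : associative repalg_mul.
Proof.
move=> x y z; rewrite -[x]aclass_repr -[y]aclass_repr -[z]aclass_repr !amulE.
by apply/aclassP; apply: ameq_mulA.
Qed.
Lemma repalg_mul_bilin : bilin repalg_mul.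
Proof.
split=> [z k x y|z k x y];
  rewrite -[x]aclass_repr -[y]aclass_repr -[z]aclass_repr -aclassZ -aclassD
    !amulE -aclassZ -aclassD; apply/aclassP.
  apply: ameq_trans (ameq_mulDl _ _ _) _; apply: ameq_add (ameq_refl _).
  exact: ameq_mulZl.
apply: ameq_trans (ameq_mulDr _ _ _) _; apply: ameq_add (ameq_refl _).
exact: ameq_mulZr.
Qed.
HB.instance Definition _ :=
  Lmodule_isNuAlg.Build K repalg repalg_mulA repalg_mul_bilin.

Definition rgen (a : A) (al : M) : repalg := aclass (AGen a al).

Lemma aclassM t u : aclass (AMul t u) = aclass t ⋅ aclass u.
Proof. by rewrite -amulE. Qed.

Lemma rgen_bilin : bilin rgen.
Proof.
split=> [al k a b|a k al be]; rewrite /rgen -aclassZ -aclassD; apply/aclassP.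
  exact: ameq_genl.
exact: ameq_genr.
Qed.

Lemma rgen_mul a b al :
  rgen (a ⋅ b) al = tsum (fun be ga => rgen a be ⋅ rgen b ga) (comul al).
Proof.
have := ameq_gen_mul a b (tensor_repr (comul al)) => /aclassP.
rewrite aclass_sum big_map {1}/rgen => ->.
by apply: eq_bigr => x _; rewrite aclassM.
Qed.

Lemma rgen_comm p q a b al be : homog p a -> homog q b ->
  rgen a al ⋅ rgen b be = isign K (p * q) *: (rgen b be ⋅ rgen a al).
Proof.
move=> ha hb; rewrite -!aclassM -aclassZ; apply/aclassP.
exact: ameq_gen_comm ha hb.
Qed.

Lemma repalg_ind (P : repalg -> Prop) :
  (forall a al, P (rgen a al)) -> P 0 -> (forall x y, P x -> P y -> P (x + y)) ->
  (forall k x, P x -> P (k *: x)) -> (forall x y, P x -> P y -> P (x ⋅ y)) ->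
  forall x, P x.
Proof.
move=> Pg P0 PD PZ PM x; rewrite -[x]aclass_repr.
elim: (repr x) => [a al||t Pt u Pu|k t Pt|t Pt u Pu].
- exact: Pg.
- exact: P0.
- by rewrite aclassD; apply: PD.
- by rewrite aclassZ; apply: PZ.
- by rewrite aclassM; apply: PM.
Qed.

Inductive repalg_homog : int -> repalg -> Prop :=
| rhomog_gen p a al : homog p a -> repalg_homog p (rgen a al)
| rhomog0 p : repalg_homog p 0
| rhomogP p k x y :
    repalg_homog p x -> repalg_homog p y -> repalg_homog p (k *: x + y)
| rhomogM p q x y :
    repalg_homog p x -> repalg_homog q y -> repalg_homog (p + q) (x ⋅ y).

Fixpoint aparts (t : amterm) : seq (int * repalg) :=
  match t with
  | AGen a al => [seq (p, rgen (hcomp p a) al) | p <- hsupp a]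
  | AZero => [::]
  | AAdd t u => aparts t ++ aparts u
  | AScale k t => [seq (x.1, k *: x.2) | x <- aparts t]
  | AMul t u => [seq (x.1 + y.1, x.2 ⋅ y.2) | x <- aparts t, y <- aparts u]
  end.

Definition acomp p (t : amterm) : repalg :=
  \sum_(x <- aparts t | x.1 == p) x.2.

Lemma linear_mull (y : repalg) : linear (fun x : repalg => x ⋅ y).
Proof. exact: (amul_bilin (s := repalg)).1. Qed.
Lemma linear_mulr (y : repalg) : linear (fun x : repalg => y ⋅ x).
Proof. exact: (amul_bilin (s := repalg)).2. Qed.

Lemma acomp_gen p a al : acomp p (AGen a al) = rgen (hcomp p a) al.
Proof.
have gl := rgen_bilin.1 al.
rewrite /acomp big_map /= big_mkcond /=.
have r0 : rgen 0 al = 0 by have := linB 0 0 gl; rewrite !subr0 subrr.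
case: (boolP (p \in hsupp a)) => pa.
  rewrite (bigD1_seq p) ?hsupp_uniq//= eqxx big1 ?addr0// => q.
  by move/negPf => ->.
rewrite hcomp_out// r0 big1_seq// => q /andP[_ qa].
by case: eqP => // qp; rewrite -qp qa in pa.
Qed.

Lemma acompD p t u : acomp p (AAdd t u) = acomp p t + acomp p u.
Proof. exact: big_cat. Qed.

Lemma acompZ p k t : acomp p (AScale k t) = k *: acomp p t.
Proof. by rewrite /acomp big_map /= scaler_sumr. Qed.

Lemma acompMl p t u : acomp p (AMul t u) =
  \sum_(x <- aparts t) x.2 ⋅ acomp (p - x.1) u.
Proof.
rewrite /acomp big_mkcond big_allpairs_dep /=; apply: eq_bigr => x _.
rewrite -big_mkcond (lin_sum_cond (linear_mulr x.2)); apply: eq_bigl => y.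
by rewrite [RHS]eq_sym subr_eq eq_sym addrC.
Qed.

Lemma acompMr p t u : acomp p (AMul t u) =
  \sum_(y <- aparts u) acomp (p - y.1) t ⋅ y.2.
Proof.
rewrite /acomp big_mkcond big_allpairs_dep exchange_big /=.
apply: eq_bigr => y _.
rewrite -big_mkcond (lin_sum_cond (linear_mull y.2)); apply: eq_bigl => x.
by rewrite [RHS]eq_sym subr_eq eq_sym.
Qed.

Lemma acomp_sum p (ts : seq amterm) :
  acomp p (asum ts) = \sum_(t <- ts) acomp p t.
Proof.
elim: ts => [|t ts IHts]; first by rewrite /acomp !big_nil.
by rewrite big_cons -IHts -acompD.
Qed.

Let mul_lin (al : M) (z : repalg) : linear (fun a => rgen a al ⋅ z).
Proof. by apply: linear_comp (linear_mull z) (rgen_bilin.1 al). Qed.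

Lemma acomp_genM p a al u : acomp p (AMul (AGen a al) u) =
  gext (fun r b => rgen b al ⋅ acomp (p - r) u) a.
Proof. by rewrite acompMl big_map. Qed.

Lemma hcompM p (a b : A) :
  hcomp p (a ⋅ b) = \sum_(r <- hsupp a) hcomp r a ⋅ hcomp (p - r) b.
Proof.
have ml (c : A) : linear (fun x : A => x ⋅ c) := (amul_bilin (s := A)).1 c.
have mr (c : A) : linear (fun x : A => c ⋅ x) := (amul_bilin (s := A)).2 c.
rewrite {1}[a]hcomp_sum (lin_sum (ml b)) (lin_sum (hcomp_linear p)).
apply: eq_bigr => r _.
rewrite {1}[b]hcomp_sum (lin_sum (mr _)) (lin_sum (hcomp_linear p)).
rewrite [in RHS](hcomp_sum b) (lin_sum (hcomp_linear (p - r))).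
rewrite (lin_sum (mr _)).
apply: eq_bigr => q _.
rewrite (hcomp_id _ (homogM _ _ _ _ (hcomp_homog r a) (hcomp_homog q b))).
rewrite (hcomp_id _ (hcomp_homog q b)) subr_eq [q + r]addrC.
case: eqP => // _; have := linB 0 0 (mr (hcomp r a)).
by rewrite !subr0 subrr.
Qed.

Lemma acomp_ameq t u : ameq t u -> forall p, acomp p t = acomp p u.
Proof.
elim=> {t u}.
- by [].
- by move=> t u _ E p; rewrite E.
- by move=> t u w _ E1 _ E2 p; rewrite E1.
- by move=> t t' u u' _ E1 _ E2 p; rewrite !acompD E1 E2.
- by move=> k t t' _ E p; rewrite !acompZ E.
- move=> t t' u u' _ E1 _ E2 p; rewrite acompMl.
  under eq_bigr do rewrite E2.
  rewrite -acompMl !acompMr; by under eq_bigr do rewrite E1.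
- by move=> t u w p; rewrite !acompD addrA.
- by move=> t u p; rewrite !acompD addrC.
- by move=> t p; rewrite acompD {1}/acomp big_nil add0r.
- by move=> k l t p; rewrite !acompZ scalerA.
- by move=> t p; rewrite acompZ scale1r.
- by move=> t p; rewrite acompZ scale0r /acomp big_nil.
- by move=> k t u p; rewrite !(acompZ, acompD) scalerDr.
- by move=> k l t p; rewrite !(acompZ, acompD) scalerDl.
- move=> t u w p; rewrite acompMl [RHS]acompMl big_allpairs_dep /=.
  apply: eq_bigr => x _; rewrite acompMl (lin_sum (linear_mulr x.2)).
  by apply: eq_bigr => y _; rewrite amulA opprD addrA.
- move=> t u w p; rewrite acompD !acompMr -big_split.
  by apply: eq_bigr => y _; rewrite acompD (linD _ _ (linear_mull y.2)).
- move=> t u w p; rewrite acompD !acompMl -big_split.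
  by apply: eq_bigr => y _; rewrite acompD (linD _ _ (linear_mulr y.2)).
- move=> k t u p; rewrite acompZ !acompMr scaler_sumr.
  by apply: eq_bigr => y _; rewrite acompZ (linZ _ _ (linear_mull y.2)).
- move=> k t u p; rewrite acompZ !acompMl scaler_sumr.
  by apply: eq_bigr => y _; rewrite acompZ (linZ _ _ (linear_mulr y.2)).
- move=> k a b al p; rewrite acompD acompZ !acomp_gen hcomp_linear.
  by rewrite rgen_bilin.1.
- by move=> k a al be p; rewrite acompD acompZ !acomp_gen rgen_bilin.2.
- move=> a b al s als p; rewrite acomp_gen acomp_sum big_map hcompM.
  rewrite (lin_sum (rgen_bilin.1 al)) /=.
  under [RHS]eq_bigr => x _ do rewrite acomp_genM /gext.
  rewrite exchange_big; apply: eq_bigr => r _ /=.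
  have /aclassP := ameq_gen_mul (hcomp r a) (hcomp (p - r) b) als.
  rewrite aclass_sum big_map {1}/rgen => ->.
  by apply: eq_bigr => x _; rewrite acomp_gen aclassM.
- move=> p q a b al be ha hb r; rewrite acompZ !acomp_genM.
  rewrite (gext_homog _ ha); last by move=> *; apply: mul_lin.
  rewrite (gext_homog _ hb); last by move=> *; apply: mul_lin.
  rewrite !acomp_gen (hcomp_id _ ha) (hcomp_id _ hb) !subr_eq [q + p]addrC.
  case: eqP => _; first exact: rgen_comm.
  have r0 c : rgen 0 c = 0.
    by have := linB 0 0 (rgen_bilin.1 c); rewrite !subr0 subrr.
  have m0 x : x ⋅ (0 : repalg) = 0.
    by have := linB 0 0 (linear_mulr x); rewrite !subr0 subrr.
  by rewrite !r0 !m0 scaler0.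
Qed.

Definition rcomp p (x : repalg) : repalg := acomp p (repr x).

Lemma rcomp_class p t : rcomp p (aclass t) = acomp p t.
Proof. by apply: acomp_ameq; apply: repr_aclass. Qed.

Lemma rcomp_linear p : linear (rcomp p).
Proof.
move=> k x y; rewrite -[x]aclass_repr -[y]aclass_repr -aclassZ -aclassD.
by rewrite !rcomp_class acompD acompZ.
Qed.

Lemma rcomp_id p q x : repalg_homog q x -> rcomp p x = if p == q then x else 0.
Proof.
move=> hx; elim: hx p => {q x}.
- move=> q a al ha p; rewrite rcomp_class acomp_gen (hcomp_id _ ha).
  case: eqP => // _.
  by have := linB 0 0 (rgen_bilin.1 al); rewrite !subr0 subrr.
- move=> q p; rewrite if_same.
  by have := linB 0 0 (rcomp_linear p); rewrite !subr0 subrr.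
- move=> q k x y _ hx _ hy p; rewrite rcomp_linear hx hy.
  by case: eqP => // _; rewrite scaler0 addr0.
- move=> q r x y _ hx _ hy p; rewrite -[x]aclass_repr -[y]aclass_repr -aclassM.
  rewrite rcomp_class acompMl.
  under eq_bigr => z _ do rewrite -rcomp_class aclass_repr hy subr_eq eq_sym.
  have -> : \sum_(z <- aparts (repr x))
      z.2 ⋅ (if r + z.1 == p then y else 0) =
      \sum_(z <- aparts (repr x) | z.1 == p - r) (z.2 ⋅ y).
    rewrite [RHS]big_mkcond; apply: eq_bigr => z _ /=.
    rewrite [z.1 == _]eq_sym subr_eq [z.1 + r]addrC eq_sym.
    case: eqP => // _.
    by have := linB 0 0 (linear_mulr z.2); rewrite !subr0 subrr.
  rewrite -(lin_sum_cond (linear_mull y)) -/(acomp _ _) -/(rcomp _ _) hx.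
  rewrite subr_eq aclassM !aclass_repr; case: eqP => // _.
  by have := linB 0 0 (linear_mull y); rewrite !subr0 subrr.
Qed.

Lemma aparts_homog t x : x \in aparts t -> repalg_homog x.1 x.2.
Proof.
elim: t x => [a al||t IHt u IHu|k t IHt|t IHt u IHu] x //=.
- by case/mapP => p _ ->; apply: rhomog_gen; apply: hcomp_homog.
- by rewrite mem_cat => /orP[/IHt|/IHu].
- case/mapP => y /IHt hy -> /=; rewrite -[_ *: _]addr0.
  by apply: rhomogP hy (rhomog0 _).
- by case/allpairsP => -[y z] /= [/IHt hy /IHu hz ->]; apply: rhomogM.
Qed.

Lemma aparts_sum t : aclass t = \sum_(x <- aparts t) x.2.
Proof.
elim: t => [a al||t IHt u IHu|k t IHt|t IHt u IHu] /=.
- rewrite big_map /= -(lin_sum (rgen_bilin.1 al)) -hcomp_sum//.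
- by rewrite big_nil.
- by rewrite big_cat aclassD IHt IHu.
- by rewrite big_map aclassZ IHt scaler_sumr.
- rewrite aclassM big_allpairs_dep IHt (lin_sum (linear_mull _)).
  by apply: eq_bigr => x _; rewrite IHu (lin_sum (linear_mulr _)).
Qed.

Lemma acomp_homog p t : repalg_homog p (acomp p t).
Proof.
rewrite /acomp big_seq_cond; elim/big_rec: _ => [|x y]; first exact: rhomog0.
case/andP => /aparts_homog hx /eqP <- hy; rewrite -[x.2]scale1r.
exact: rhomogP.
Qed.

Lemma repalg_span (x : repalg) : exists (s : seq int) (y : int -> repalg),
  [/\ uniq s, forall p, repalg_homog p (y p) & x = \sum_(p <- s) y p].
Proof.
set ps := aparts (repr x).
exists (undup [seq z.1 | z <- ps]), (fun p => acomp p (repr x)); split.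
- exact: undup_uniq.
- by move=> p; apply: acomp_homog.
rewrite -[LHS]aclass_repr aparts_sum /acomp -/ps.
rewrite (exchange_big_dep xpredT)//= big_seq [RHS]big_seq.
apply: eq_bigr => z zs; rewrite -big_filter.
rewrite (_ : filter _ _ = [:: z.1]) ?big_seq1//.
have zu : z.1 \in undup [seq z.1 | z <- ps] by rewrite mem_undup map_f.
rewrite (eq_filter (a2 := pred1 z.1)); last by move=> i; rewrite /= eq_sym.
exact: filter_pred1_uniq (undup_uniq _) zu.
Qed.

Lemma repalg_indep (s : seq int) (y : int -> repalg) : uniq s ->
  (forall p, repalg_homog p (y p)) -> \sum_(p <- s) y p = 0 ->
  forall p, p \in s -> y p = 0.
Proof.
move=> us hy s0 p ps; have := congr1 (rcomp p) s0.
rewrite (lin_sum (rcomp_linear p)) (bigD1_seq p)//= (rcomp_id _ (hy p)) eqxx.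
rewrite big1 => [|q /negPf qp]; last by rewrite (rcomp_id _ (hy q)) eq_sym qp.
by rewrite addr0 (rcomp_id _ (rhomog0 p)) eqxx.
Qed.

HB.instance Definition _ := NuAlg_isGraded.Build K repalg
  rhomog0 rhomogP rhomogM repalg_span repalg_indep.

End RepAlg.

Section Action.
Variables (K : comPzRingType) (A : gradedAlgType K) (M : coalgType K).
Local Notation AM := (repalg A M).

Section Derivation.
Variable phi : {linear M -> K^o}.

Fixpoint aderiv (t : amterm A M) : AM :=
  match t with
  | AGen a al => rgen a (deltaM phi al)
  | AZero => 0
  | AAdd t u => aderiv t + aderiv u
  | AScale k t => k *: aderiv t
  | AMul t u => aderiv t ⋅ aclass u + aclass t ⋅ aderiv u
  end.

Lemma aderiv_sum (ts : seq (amterm A M)) :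
  aderiv (asum ts) = \sum_(t <- ts) aderiv t.
Proof. by elim: ts => [|t ts IHts]; rewrite ?big_nil// big_cons -IHts. Qed.

Lemma aderiv_ameq t u : ameq t u -> aderiv t = aderiv u.
Proof.
have ml (c : AM) := linear_mull c; have mr (c : AM) := linear_mulr c.
elim=> {t u} /=.
- by [].
- by [].
- by move=> t u w _ -> _ ->.
- by move=> t t' u u' _ -> _ ->.
- by move=> k t t' _ ->.
- by move=> t t' u u' /aclassP -> -> /aclassP -> ->.
- by move=> t u w; rewrite addrA.
- by move=> t u; rewrite addrC.
- by move=> t; rewrite add0r.
- by move=> k l t; rewrite scalerA.
- by move=> t; rewrite scale1r.
- by move=> t; rewrite scale0r.
- by move=> k t u; rewrite scalerDr.
- by move=> k l t; rewrite scalerDl.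
- move=> t u w; rewrite !aclassM (linD _ _ (mr _)) (linD _ _ (ml _)).
  by rewrite !amulA addrA.
- move=> t u w; rewrite !aclassD !(linD _ _ (ml _)).
  by rewrite addrACA.
- move=> t u w; rewrite !aclassD !(linD _ _ (mr _)).
  by rewrite addrACA.
- by move=> k t u; rewrite !aclassZ !(linZ _ _ (ml _)) scalerDr.
- by move=> k t u; rewrite !aclassZ !(linZ _ _ (mr _)) scalerDr.
- by move=> k a b al; rewrite (rgen_bilin A M).1.
- by move=> k a al be; rewrite deltaM_linear (rgen_bilin A M).2.
- move=> a b al s als; rewrite aderiv_sum big_map /= rgen_mul deltaM_coder.
  have gr (c : A) : linear (rgen c : M -> AM) := (rgen_bilin A M).2 c.
  have bl : bilin (fun be ga : M => (rgen a be : AM) ⋅ rgen b ga).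
    split=> z; [exact: linear_comp (ml _) (gr a)|exact: linear_comp (mr _) (gr b)].
  rewrite (lin_tsum _ _ (tsum_linear bl)).
  have bl2 : bilin (fun y z : M => tsum (fun be ga : M => (rgen a be : AM) ⋅ rgen b ga)
     (deltaM phi y ⊗ z + y ⊗ deltaM phi z)).
    have dl := deltaM_linear phi; have il := @linear_idfun K M.
    split=> z; apply: linear_comp (tsum_linear bl) _; apply: linear_add.
    - exact: linear_tensl dl.
    - exact: linear_tensl il.
    - exact: linear_tensr il.
    - exact: linear_tensr dl.
  rewrite als (lin_sum (tsum_linear bl2)); apply: eq_bigr => x _.
  by rewrite (tsum_tens bl2) (linD _ _ (tsum_linear bl)) !(tsum_tens bl).
- move=> p q a b al be ha hb.
  rewrite scalerDr addrC; congr (_ + _); exact: rgen_comm.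
Qed.

Definition delta (x : AM) : AM := aderiv (repr x).

Lemma delta_class t : delta (aclass t) = aderiv t.
Proof. by apply: aderiv_ameq; apply: repr_aclass. Qed.

Lemma delta_gen a al : delta (rgen a al) = rgen a (deltaM phi al).
Proof. exact: delta_class. Qed.

Lemma delta_linear : linear delta.
Proof.
move=> k x y; rewrite -[x]aclass_repr -[y]aclass_repr -aclassZ -aclassD.
by rewrite !delta_class.
Qed.

Lemma delta_mul (x y : AM) : delta (x ⋅ y) = delta x ⋅ y + x ⋅ delta y.
Proof.
by rewrite -[x]aclass_repr -[y]aclass_repr -aclassM !delta_class.
Qed.

Lemma delta_homog p (x : AM) : homog p x -> homog p (delta x).
Proof.
move=> hx; have {hx} : repalg_homog p x by [].
have d0 : delta 0 = 0.
  by have := linB 0 0 delta_linear; rewrite !subr0 subrr.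
elim=> {p x}.
- by move=> p a al ha; rewrite delta_gen; apply: rhomog_gen.
- by move=> p; rewrite d0; apply: rhomog0.
- by move=> p k x y _ hx _ hy; rewrite delta_linear; apply: rhomogP.
- move=> p q x y hx dx hy dy; rewrite delta_mul.
  by apply: homogD; apply: homogM.
Qed.

End Derivation.

Lemma delta_bracket (phi psi : {linear M -> K^o}) (x : AM) :
  delta (dual_bracket phi psi) x =
  delta phi (delta psi x) - delta psi (delta phi x).
Proof.
have dl f := delta_linear f.
elim/repalg_ind: x => [a al||x y hx hy|k x hx|x y hx hy].
- rewrite !delta_gen deltaM_bracket.
  exact: (linB _ _ ((rgen_bilin A M).2 a)).
- have d0 f : delta f 0 = 0 by have := linB 0 0 (dl f); rewrite !subr0 subrr.
  by rewrite !d0 subr0.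
- by rewrite !(linD _ _ (dl _)) hx hy opprD addrACA.
- by rewrite !(linZ _ _ (dl _)) hx scalerBr.
- rewrite !delta_mul !(linD _ _ (dl _)) !delta_mul hx hy.
  rewrite (linB _ _ (linear_mull y)) (linB _ _ (linear_mulr x)).
  set a := _ ⋅ y; set b := _ ⋅ y; set c := x ⋅ _; set d := x ⋅ _.
  by rewrite !opprD [RHS](AC ((2*2)*(2*2)) (1*5*(4*8)*(2*7)*(3*6))) /= !subrr !addr0.
Qed.

Definition repalg_inv (x : AM) : Prop :=
  forall phi : {linear M -> K^o}, delta phi x = 0.

Lemma repalg_invP k x y :
  repalg_inv x -> repalg_inv y -> repalg_inv (k *: x + y).
Proof.
by move=> hx hy phi; rewrite delta_linear hx hy scaler0 addr0.
Qed.

Lemma repalg_invM x y : repalg_inv x -> repalg_inv y -> repalg_inv (x ⋅ y).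
Proof.
move=> hx hy phi; rewrite delta_mul hx hy.
have m0l : (0 : AM) ⋅ y = 0.
  by have := linB 0 0 (linear_mull y); rewrite !subr0 subrr.
have m0r : x ⋅ (0 : AM) = 0.
  by have := linB 0 0 (linear_mulr x); rewrite !subr0 subrr.
by rewrite m0l m0r addr0.
Qed.

Lemma repalg_inv_comp p x : repalg_inv x -> repalg_inv (hcomp p x).
Proof.
move=> hx phi; have dl := delta_linear phi.
have d0 : delta phi 0 = 0 by have := linB 0 0 dl; rewrite !subr0 subrr.
have := hx phi; rewrite {1}[x]hcomp_sum (lin_sum dl).
have dh q : homog q (delta phi (hcomp q x)).
  by apply: delta_homog; apply: hcomp_homog.
case: (boolP (p \in hsupp x)) => [ps s0|/hcomp_out -> //].
exact: (homog_indep _ _ (hsupp_uniq x) dh s0 p ps).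
Qed.

End Action.

Section DoubleBracket.
Variables (K : comPzRingType) (A : gradedAlgType K).
Local Notation AA := (tensor A A).

(* a (x) b |-> (-1)^(|a|_n |b|_n) b (x) a *)
Definition P21 (n : int) (z : AA) : AA :=
  tsum (fun a b => gext (fun p a' => gext (fun q b' =>
    isign K ((p + n) * (q + n)) *: (b' ⊗ a')) b) a) z.

Let gext_plin (U V : lmodType K) (F : U -> int -> A -> V) a :
  (forall p b, linear (fun u => F u p b)) -> linear (fun u => gext (F u) a).
Proof.
move=> Fl k u w; rewrite /gext scaler_sumr -big_split.
by apply: eq_bigr => p _; apply: Fl.
Qed.

Let gtwo_bilin (V : lmodType K) (f : int -> int -> A -> A -> V) :
  (forall p q, bilin (f p q)) ->
  bilin (fun a b => gext (fun p a' => gext (fun q b' => f p q a' b') b) a).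
Proof.
move=> fb; have gl p b : linear (fun a' => gext (fun q b' => f p q a' b') b).
  move=> k u w; rewrite /gext scaler_sumr -big_split.
  by apply: eq_bigr => q _; apply: (fb p q).1.
split=> [b|a]; first by apply: gext_linear => p; apply: gl.
move=> k u w; rewrite /gext scaler_sumr -big_split.
by apply: eq_bigr => p _; exact: (gext_linear (fun q => (fb p q).2 (hcomp p a))).
Qed.

Let gtwo_homog (V : lmodType K) (f : int -> int -> A -> A -> V) p q a b :
  (forall p q, bilin (f p q)) -> homog p a -> homog q b ->
  gext (fun p a' => gext (fun q b' => f p q a' b') b) a = f p q a b.
Proof.
move=> fb ha hb; rewrite (gext_homog _ ha) ?(gext_homog _ hb)//.
  by move=> r; apply: (fb p r).2.
move=> r k u w; rewrite /gext scaler_sumr -big_split.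
by apply: eq_bigr => s _; apply: (fb r s).1.
Qed.

Let sc_bilin (M N V : lmodType K) (k : K) (f : M -> N -> V) :
  bilin f -> bilin (fun m n => k *: f m n).
Proof. by case=> f1 f2; split=> ?; apply: linear_scr. Qed.

Let swap_bilin : bilin (fun a b : A => b ⊗ a).
Proof.
by split=> c; [apply: linear_tensr | apply: linear_tensl]; apply: linear_idfun.
Qed.

Lemma P21_linear n : linear (P21 n).
Proof.
by apply: tsum_linear; apply: gtwo_bilin => p q; apply/sc_bilin/swap_bilin.
Qed.

Lemma P21_homog n p q (a b : A) : homog p a -> homog q b ->
  P21 n (a ⊗ b) = isign K ((p + n) * (q + n)) *: (b ⊗ a).
Proof.
move=> ha hb.
have fb r s : bilin (fun a b : A => isign K ((r + n) * (s + n)) *: (b ⊗ a)).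
  exact/sc_bilin/swap_bilin.
rewrite /P21 tsum_tens; last exact: gtwo_bilin.
exact: (gtwo_homog fb ha hb).
Qed.

(* a(x (x) y) and (x (x) y)b *)
Definition outerl (a : A) (z : AA) : AA := tsum (fun x y => (a ⋅ x) ⊗ y) z.
Definition outerr (z : AA) (b : A) : AA := tsum (fun x y => x ⊗ (y ⋅ b)) z.

(* a * (x (x) y) = (-1)^(|a||x|) x (x) ay                                     *)
(* (x (x) y) * b = (-1)^(|b||y|) xb (x) y                                     *)
Definition innerl (a : A) (z : AA) : AA :=
  tsum (fun x y => gext (fun p a' => gext (fun q x' =>
    isign K (p * q) *: (x' ⊗ (a' ⋅ y))) x) a) z.
Definition innerr (z : AA) (b : A) : AA :=
  tsum (fun x y => gext (fun p b' => gext (fun q y' =>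
    isign K (p * q) *: ((x ⋅ b') ⊗ y')) y) b) z.

Let ml (c : A) : linear (fun x : A => x ⋅ c) := (amul_bilin (s := A)).1 c.
Let mr (c : A) : linear (fun x : A => c ⋅ x) := (amul_bilin (s := A)).2 c.
Let il := @linear_idfun K A.

Lemma outerl_tens a x y : outerl a (x ⊗ y) = (a ⋅ x) ⊗ y.
Proof.
by apply: tsum_tens; split=> c; [apply/linear_tensl/mr | apply/linear_tensr/il].
Qed.

Lemma outerr_tens b x y : outerr (x ⊗ y) b = x ⊗ (y ⋅ b).
Proof.
by apply: tsum_tens; split=> c; [apply/linear_tensl/il | apply/linear_tensr/ml].
Qed.

Lemma innerl_homog p q (a x y : A) : homog p a -> homog q x ->
  innerl a (x ⊗ y) = isign K (p * q) *: (x ⊗ (a ⋅ y)).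
Proof.
move=> ha hx.
have fb z r s : bilin (fun a x : A => isign K (r * s) *: (x ⊗ (a ⋅ z))).
  by apply: sc_bilin; split=> c; [apply/linear_tensr/ml | apply/linear_tensl/il].
rewrite /innerl tsum_tens; first exact: (gtwo_homog (fb y) ha hx).
split=> c; last first.
  by apply: gext_plin => r d; apply: gext_plin => s e; exact/linear_scr/linear_tensr/mr.
exact: (gtwo_bilin (fb c)).2.
Qed.

Lemma innerr_homog p q (b x y : A) : homog p b -> homog q y ->
  innerr (x ⊗ y) b = isign K (p * q) *: ((x ⋅ b) ⊗ y).
Proof.
move=> hb hy.
have fb z r s : bilin (fun b y : A => isign K (r * s) *: ((z ⋅ b) ⊗ y)).
  by apply: sc_bilin; split=> c; [apply/linear_tensl/mr | apply/linear_tensr/il].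
rewrite /innerr tsum_tens; first exact: (gtwo_homog (fb x) hb hy).
split=> c; last exact: (gtwo_bilin (fb c)).2.
by apply: gext_plin => r d; apply: gext_plin => s e; exact/linear_scr/linear_tensl/ml.
Qed.

(* the direct sum of the A^i (x) A^j for i + j = d *)
Definition tensor_homog (d : int) (z : AA) : Prop :=
  exists s : seq (A * A),
    (forall x, x \in s -> exists i j : int,
       [/\ i + j = d, homog i x.1 & homog j x.2]) /\
    z = \sum_(x <- s) x.1 ⊗ x.2.

Record double_bracket (n : int) (D : {linear AA -> AA}) : Prop := {
  db_degree : forall p q (a b : A), homog p a -> homog q b ->
    tensor_homog (p + q + n) (D (a ⊗ b));
  db_skew : forall z, D (P21 n z) = - P21 0 (D z);
  db_derr : forall p q r (a b c : A), homog p a -> homog q b -> homog r c ->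
    D (a ⊗ (b ⋅ c)) = outerr (D (a ⊗ b)) c
                      + isign K ((p + n) * q) *: outerl b (D (a ⊗ c));
  db_derl : forall p q r (a b c : A), homog p a -> homog q b -> homog r c ->
    D ((a ⋅ b) ⊗ c) = innerl a (D (b ⊗ c))
                      + isign K (q * (r + n)) *: innerr (D (a ⊗ c)) b
}.

End DoubleBracket.

Record biderivation (K : comPzRingType) (B : gradedAlgType K) (n : int)
    (br : {linear tensor B B -> B}) : Prop := {
  bid_degree : forall p q (a b : B), homog p a -> homog q b ->
    homog (p + q + n) (br (a ⊗ b));
  bid_derr : forall p q r (a b c : B), homog p a -> homog q b -> homog r c ->
    br (a ⊗ (b ⋅ c)) = br (a ⊗ b) ⋅ c + isign K ((p + n) * q) *: (b ⋅ br (a ⊗ c));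
  bid_derl : forall p q r (a b c : B), homog p a -> homog q b -> homog r c ->
    br ((a ⋅ b) ⊗ c) = a ⋅ br (b ⊗ c) + isign K (q * (r + n)) *: (br (a ⊗ c) ⋅ b);
  bid_skew : forall p q (a b : B), homog p a -> homog q b ->
    br (a ⊗ b) = - (isign K ((p + n) * (q + n)) *: br (b ⊗ a))
}.

Section Cyclic.
Variables (K : comPzRingType) (M : coalgType K).

Definition flip (z : tensor M M) : tensor M M := tsum (fun al be => be ⊗ al) z.

(* al (x) be |-> v(al (x) be^2) be^1 (x) be^3 *)
Definition vhat (v : {linear tensor M M -> K^o}) (z : tensor M M) : tensor M M :=
  tsum (fun al be =>
    tsum3 (fun be1 be2 be3 => (v (al ⊗ be2) : K) *: (be1 ⊗ be3)) (comul3 be)) z.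

Lemma flip_tens al be : flip (al ⊗ be) = be ⊗ al.
Proof.
apply: tsum_tens.
by split=> c; [apply: linear_tensr | apply: linear_tensl]; apply: linear_idfun.
Qed.

Lemma vhat_tens v al be : vhat v (al ⊗ be) =
  tsum3 (fun be1 be2 be3 => (v (al ⊗ be2) : K) *: (be1 ⊗ be3)) (comul3 be).
Proof.
apply: tsum_tens; have il := @linear_idfun K M.
have vl : linear (v : _ -> K^o) by exact: linearP.
have cl : linear (@comul K M) by move=> k u w; rewrite linearP.
split=> c.
  apply: tsum_plin => y b3; apply: tsum_plin => b1 b2.
  exact: linear_sc (linear_comp vl (linear_tensl b2 il)).
have tl : trilin (fun be1 be2 be3 : M => (v (c ⊗ be2) : K) *: (be1 ⊗ be3)).
  split=> ? ?; [exact/linear_scr/linear_tensl | | exact/linear_scr/linear_tensr].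
  exact: linear_sc (linear_comp vl (linear_tensr c il)).
have [g1 g2 g3] := tl.
have l3 : linear (tsum3 (fun be1 be2 be3 : M => (v (c ⊗ be2) : K) *: (be1 ⊗ be3))).
  apply: tsum_linear; split=> [n|y].
    by apply: tsum_linear; split=> ?; [apply: g1 | apply: g2].
  by apply: tsum_plin => ? ?; apply: g3.
have lc : linear (@comul3 K M).
  have cb : bilin (fun y z : M => comul y ⊗ z).
    by split=> y; [apply: linear_tensl cl | apply: linear_tensr il].
  exact: linear_comp (tsum_linear cb) cl.
exact: linear_comp l3 lc.
Qed.

Definition cyclic_form (v : {linear tensor M M -> K^o}) : Prop :=
  forall z, vhat v (flip z) = flip (vhat v z).

End Cyclic.

(* [br] is the bracket {-,-}_v induced by the double bracket [D] and the      *)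
(* form [v]: since the [rgen a al] generate A_M, there is at most one such    *)
(* [br].                                                                      *)
Definition induced_bracket (K : comPzRingType) (A : gradedAlgType K)
    (M : coalgType K) (n : int) (D : {linear tensor A A -> tensor A A})
    (v : {linear tensor M M -> K^o})
    (br : {linear tensor (repalg A M) (repalg A M) -> repalg A M}) : Prop :=
  biderivation n br /\
  forall (a b : A) (al be : M),
    br (rgen a al ⊗ rgen b be) =
    tsum3 (fun be1 be2 be3 => (v (al ⊗ be2) : K) *:
      tsum (fun x y => (rgen x be1 : repalg A M) ⋅ rgen y be3) (D (a ⊗ b)))
      (comul3 be).

Definition action_invariant (K : comPzRingType) (A : gradedAlgType K)
    (M : coalgType K)
    (br : {linear tensor (repalg A M) (repalg A M) -> repalg A M}) : Prop :=
  forall (phi : {linear M -> K^o}) (x y : repalg A M),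
    delta phi (br (x ⊗ y)) = br (delta phi x ⊗ y) + br (x ⊗ delta phi y).

(* Main.v *)
Require Import Defs.
From mathcomp Require Import all_boot all_order all_algebra.
Import GRing.Theory.
Local Open Scope ring_scope.

(** Fix [phi] and write [delta] for its action both on [M] and on [A_M].  The
    defect [delta {x, y} - {delta x, y} - {x, delta y}] of a biderivation is
    itself a derivation in each of its two homogeneous arguments, because
    [delta] is a derivation of degree zero.  Hence it vanishes as soon as it
    vanishes on generators ([biderivation_invariant]).

    On generators, [delta] of the bracket of [a_alpha] and [b_beta] lets [delta]
    act on [beta^1] and on [beta^3].  As [delta] is a coderivation, replacing
    [beta] by [delta beta] lets it act on [beta^1], [beta^2] and [beta^3] in turn
    ([comul3_coder]).  Two of the three terms agree with the former ones and what
    remains, up to sign, is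
    [(v (delta alpha, beta^2) + v (alpha, delta beta^2)) x_(beta^1) y_(beta^3)].

    So everything rests on the identity
    [v (delta alpha, beta) + v (alpha, delta beta) = 0] ([cyclic_form_deltaM]).
    Cyclicity equates [v (beta, alpha^2) alpha^1 (x) alpha^3] with
    [v (alpha, beta^2) beta^3 (x) beta^1].  Contracting the two legs with
    [counit (x) counit] shows that [v] is symmetric, and contracting them with
    [counit (x) phi] and with [phi (x) counit] shows that [delta] is
    antisymmetric for [v]. *)

(** * Bilinear maps and iterated comultiplication *)

Lemma linear0_map {K : comPzRingType} {U V : lmodType K} {h : U -> V} :
  linear h -> h 0 = 0.
Proof. by move=> hl; have := linB 0 0 hl; rewrite !subrr. Qed.

Lemma linear_linmap {K : comPzRingType} {U V : lmodType K} (f : {linear U -> V}) :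
  linear (f : U -> V).
Proof. exact: linearP. Qed.

Lemma eq_tsum3 {K : comPzRingType} {L M N V : lmodType K}
    {g h : L -> M -> N -> V} (t : tensor (tensor L M) N) :
  (forall a b c, g a b c = h a b c) -> tsum3 g t = tsum3 h t.
Proof. by move=> gh; apply: eq_tsum => y c; apply: eq_tsum => a b. Qed.

Section IteratedComul.
Context {K : comPzRingType} {M : coalgType K} {V : lmodType K}.
Implicit Types (g : M -> M -> M -> V) (x : M).

Let cl : linear (@comul K M) := linear_linmap comul.

(** The slice [y (x) z |-> g y^1 y^2 z]: since [comul3] comultiplies the left
    factor of [comul x], this bilinear map reduces statements on [comul3] to
    statements on [comul]. *)
Definition comull g (y z : M) : V := tsum (fun y1 y2 => g y1 y2 z) (comul y).

Lemma comull_bilin g : trilin g -> bilin (comull g).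
Proof.
case=> g1 g2 g3; split=> [z|y]; last by apply: tsum_plin => y1 y2; apply: g3.
apply: linear_comp cl; apply: tsum_linear.
by split=> c; [apply: g1 | apply: g2].
Qed.

Lemma tsum3_comul3 g x : trilin g ->
  tsum3 g (comul3 x) = tsum (comull g) (comul x).
Proof.
case=> g1 g2 g3; rewrite /tsum3 /comul3.
have bl : bilin (fun (y : tensor M M) n => tsum (fun l m => g l m n) y).
  split=> [n|y]; last by apply: tsum_plin => l m; apply: g3.
  by apply: tsum_linear; split=> c; [apply: g1 | apply: g2].
rewrite (lin_tsum _ _ (tsum_linear bl)); apply: eq_tsum => y z.
by rewrite (tsum_tens bl).
Qed.

(** Applying the coderivation rule twice: once to [comul x], once to its left
    factor. *)
Lemma comul3_coder (phi : {linear M -> K^o}) g x : trilin g ->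
  tsum3 g (comul3 (deltaM phi x)) =
    tsum3 (fun a b c => g (deltaM phi a) b c) (comul3 x)
  + tsum3 (fun a b c => g a (deltaM phi b) c) (comul3 x)
  + tsum3 (fun a b c => g a b (deltaM phi c)) (comul3 x).
Proof.
move=> tg; have [g1 g2 g3] := tg; have dl := deltaM_linear phi.
have coder (h : M -> M -> V) y : bilin h ->
    tsum h (comul (deltaM phi y)) =
    tsum (fun a b => h (deltaM phi a) b + h a (deltaM phi b)) (comul y).
  move=> hb; rewrite deltaM_coder (lin_tsum _ _ (tsum_linear hb)).
  apply: eq_tsum => a b.
  by rewrite (linD _ _ (tsum_linear hb)) !(tsum_tens hb).
rewrite !tsum3_comul3 //; first last.
- split=> *; [exact: linear_comp (g1 _ _) dl | exact: g2 | exact: g3].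
- split=> *; [exact: g1 | exact: linear_comp (g2 _ _) dl | exact: g3].
- split=> *; [exact: g1 | exact: g2 | exact: linear_comp (g3 _ _) dl].
rewrite (coder _ _ (comull_bilin g tg)) -!tsumD; apply: eq_tsum => y z.
congr (_ + _); rewrite /comull coder ?tsumD //.
Qed.

End IteratedComul.

Section CounitContraction.
Context {K : comPzRingType} {M : counitalCoalgType K} {V : lmodType K}.
Variables (g : M -> M -> V) (x : M).
Hypothesis gb : bilin g.

Let el : linear (counit : M -> K^o) := linear_linmap counit.

Lemma tsum3_counitl :
  tsum3 (fun a b c => (counit a : K) *: g b c) (comul3 x) = tsum g (comul x).
Proof.
have [g1 g2] := gb; rewrite tsum3_comul3; last first.
  by split=> *; [exact: linear_sc|apply: linear_scr..].
apply: eq_tsum => y z; rewrite -[in RHS](counitl y) (lin_tsum _ _ (g1 z)).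
by apply: eq_tsum => a b; rewrite (linZ _ _ (g1 z)).
Qed.

Lemma tsum3_counitr :
  tsum3 (fun a b c => (counit c : K) *: g a b) (comul3 x) = tsum g (comul x).
Proof.
have [g1 g2] := gb; rewrite tsum3_comul3; last first.
  by split=> *; [apply: linear_scr..|exact: linear_sc].
have Gl : linear (fun y : M => tsum g (comul y)).
  exact: linear_comp (tsum_linear gb) (linear_linmap comul).
rewrite -[in RHS](counitr x) (lin_tsum _ _ Gl); apply: eq_tsum => y z.
by rewrite (linZ _ _ Gl) /comull /tsum scaler_sumr.
Qed.

End CounitContraction.

(** * Cyclic forms *)

(** The equality of [vhat v (be (x) al)] with the flip of [vhat v (al (x) be)],
    in the form in which it is used: tested against bilinear maps. *)
Lemma cyclic_formP {K : comPzRingType} {M : coalgType K} {V : lmodType K}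
    {v : {linear tensor M M -> K^o}} {h : M -> M -> V} (al be : M) :
  cyclic_form v -> bilin h ->
  tsum3 (fun a1 a2 a3 => (v (be ⊗ a2) : K) *: h a1 a3) (comul3 al) =
  tsum3 (fun b1 b2 b3 => (v (al ⊗ b2) : K) *: h b3 b1) (comul3 be).
Proof.
move=> vc hb; have Hl := tsum_linear hb.
have hE (k : M -> M -> V) c z : bilin k ->
    tsum k (vhat v (c ⊗ z)) =
    tsum3 (fun a1 a2 a3 => (v (c ⊗ a2) : K) *: k a1 a3) (comul3 z).
  move=> kb; have kl := tsum_linear kb.
  rewrite vhat_tens /tsum3 (lin_tsum _ _ kl); apply: eq_tsum => y a3.
  rewrite (lin_tsum _ _ kl); apply: eq_tsum => a1 a2.
  by rewrite (linZ _ _ kl) (tsum_tens kb).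
have h'b : bilin (fun a b => h b a) by split=> c; [apply: hb.2 | apply: hb.1].
rewrite -hE // -(hE (fun a b => h b a)) // -flip_tens vc.
rewrite /flip (lin_tsum _ _ Hl); apply: eq_tsum => a b.
by rewrite (tsum_tens hb).
Qed.

Section CyclicForm.
Context {K : comPzRingType} {M : counitalCoalgType K}.
Variable v : {linear tensor M M -> K^o}.
Hypothesis vc : cyclic_form v.

Let vl : linear (v : _ -> K^o) := linear_linmap v.
Let il := @linear_idfun K M.

Let pair_bilin (f g : {linear M -> K^o}) :
  bilin (fun a b : M => (f a : K) *: g b).
Proof.
split=> c; [exact: (linear_sc _ (linear_linmap f))|].
exact: linear_scr (linear_linmap g).
Qed.

Let vlinr (c : M) : linear (fun b : M => v (c ⊗ b)) :=
  linear_comp vl (linear_tensr c il).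

Let vphi_bilin (phi : {linear M -> K^o}) (c : M) :
  bilin (fun y z : M => (phi z : K) *: v (c ⊗ y)).
Proof.
split=> d; [exact: linear_scr|exact: (linear_sc _ (linear_linmap phi))].
Qed.

Let phiv_bilin (phi : {linear M -> K^o}) (c : M) :
  bilin (fun y z : M => (phi y : K) *: v (c ⊗ z)).
Proof.
split=> d; [exact: (linear_sc _ (linear_linmap phi))|exact: linear_scr].
Qed.

(** Cyclicity contracted with [counit (x) phi]. *)
Lemma cyclic_form_contract (phi : {linear M -> K^o}) (al be : M) :
  tsum (fun y z => (phi z : K) *: v (be ⊗ y)) (comul al) =
  tsum (fun y z => (phi y : K) *: v (al ⊗ z)) (comul be).
Proof.
rewrite -(tsum3_counitl _ _ (vphi_bilin phi be)).
rewrite -(tsum3_counitr _ _ (phiv_bilin phi al)).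
transitivity (tsum3 (fun a b c => (v (be ⊗ b) : K) *: ((counit a : K) *: phi c))
  (comul3 al)).
  by apply: eq_tsum3 => a b c; rewrite /GRing.scale /= [RHS]mulrC -mulrA.
rewrite (cyclic_formP al be vc (pair_bilin counit phi)).
by apply: eq_tsum3 => a b c; rewrite /GRing.scale /= mulrC -mulrA.
Qed.

Lemma cyclic_form_sym (al be : M) : v (be ⊗ al) = v (al ⊗ be).
Proof.
have := cyclic_form_contract counit al be.
have E1 : tsum (fun y z => (counit z : K) *: v (be ⊗ y)) (comul al) = v (be ⊗ al).
  rewrite -[in RHS](counitr al) (lin_tsum _ _ (vlinr be)).
  by apply: eq_tsum => y z; rewrite (linZ _ _ (vlinr be)).
have E2 : tsum (fun y z => (counit y : K) *: v (al ⊗ z)) (comul be) = v (al ⊗ be).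
  rewrite -[in RHS](counitl be) (lin_tsum _ _ (vlinr al)).
  by apply: eq_tsum => y z; rewrite (linZ _ _ (vlinr al)).
by rewrite E1 E2.
Qed.

(** Both sides of the contracted cyclicity relation occur in [v (be, delta al)],
    the second with [al] and [be] exchanged; the exchange reverses the sign. *)
Lemma cyclic_form_deltaM (phi : {linear M -> K^o}) (al be : M) :
  v (deltaM phi al ⊗ be) + v (al ⊗ deltaM phi be) = 0.
Proof.
have E c d : v (c ⊗ deltaM phi d) =
    tsum (fun y z => (phi z : K) *: v (c ⊗ y)) (comul d)
  - tsum (fun y z => (phi y : K) *: v (c ⊗ z)) (comul d).
  rewrite /deltaM (lin_tsum _ _ (vlinr c)) -tsumB; apply: eq_tsum => y z.
  by rewrite (linB _ _ (vlinr c)) !(linZ _ _ (vlinr c)).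
rewrite cyclic_form_sym !E !cyclic_form_contract.
by rewrite addrA subrK subrr.
Qed.

End CyclicForm.

(** * Invariance of biderivations *)

Section Invariance.
Context {K : comPzRingType} {A : gradedAlgType K} {M : coalgType K}.
Local Notation AM := (repalg A M).
Variables (n : int) (br : {linear tensor AM AM -> AM}).
Hypothesis brP : biderivation n br.

Let il := @linear_idfun K AM.
Let brl (y : AM) : linear (fun x : AM => br (x ⊗ y)) :=
  linear_comp (linear_linmap br) (linear_tensl y il).
Let brr (x : AM) : linear (fun y : AM => br (x ⊗ y)) :=
  linear_comp (linear_linmap br) (linear_tensr x il).

(** Induction on [y] for a fixed homogeneous [x], then on [x].  Only homogeneous
    elements are admissible in between, since the signs in the product rules
    depend on degrees; [delta] preserves degrees, so the signs for
    [delta x, y] and for [x, delta y] are those for [x, y]. *)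
Lemma biderivation_invariant (phi : {linear M -> K^o}) :
  (forall (a b : A) (al be : M),
     delta phi (br (rgen a al ⊗ rgen b be)) =
     br (rgen a (deltaM phi al) ⊗ rgen b be)
     + br (rgen a al ⊗ rgen b (deltaM phi be))) ->
  forall x y : AM,
  delta phi (br (x ⊗ y)) = br (delta phi x ⊗ y) + br (x ⊗ delta phi y).
Proof.
move=> Hgen; have dl := delta_linear (A := A) phi.
pose inv x y :=
  delta phi (br (x ⊗ y)) = br (delta phi x ⊗ y) + br (x ⊗ delta phi y).
have invr (x : AM) :
    linear (fun y => br (delta phi x ⊗ y) + br (x ⊗ delta phi y)).
  exact: linear_add (brr _) (linear_comp (brr _) dl).
have invl (y : AM) :
    linear (fun x => br (delta phi x ⊗ y) + br (x ⊗ delta phi y)).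
  exact: linear_add (linear_comp (brl _) dl) (brl _).
have dbr (x : AM) := linear_comp dl (brr x).
have dbl (y : AM) := linear_comp dl (brl y).
(* The defect is a derivation in [y]: if it vanishes on the generators, it does
   so on every homogeneous [y]. *)
have Hr p x q y : homog p x -> (forall b be, inv x (rgen b be)) ->
    homog q y -> inv x y.
  move=> hx xg hy; have {hy} : repalg_homog q y by [].
  elim=> {q y}.
  - by move=> q b be _; apply: xg.
  - by move=> q; rewrite /inv (linear0_map (dbr x)) (linear0_map (invr x)).
  - by move=> q k y z _ hy _ hz; rewrite /inv (dbr x) hy hz -(invr x).
  - move=> q r y z hy Iy hz Iz; rewrite /inv delta_mul (linD _ _ (brr x)).
    have hdx := delta_homog phi hx.
    have hdy := delta_homog phi hy; have hdz := delta_homog phi hz.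
    rewrite !(bid_derr brP hx hy hz, bid_derr brP hdx hy hz,
      bid_derr brP hx hdy hz, bid_derr brP hx hy hdz).
    rewrite (linD _ _ dl) (linZ _ _ dl) !delta_mul Iy Iz.
    rewrite (linD _ _ (linear_mull z)) (linD _ _ (linear_mulr y)) !scalerDr.
    by rewrite [LHS](AC (3*(1*2)) ((1*5)*((2*4)*(3*6)))).
(* For a generator [x] of degree [p], the previous step reduces the claim to a
   pair of generators; products are treated by the derivation rule in [x]. *)
have Hl p x q y : homog q y -> homog p x -> inv x y.
  move=> hy hx; have {hx} : repalg_homog p x by [].
  elim=> {p x}.
  - move=> p a al ha; apply: (Hr p _ q) hy; first exact: rhomog_gen.
    by move=> b be; rewrite /inv !delta_gen; apply: Hgen.
  - by move=> p; rewrite /inv (linear0_map (dbl y)) (linear0_map (invl y)).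
  - by move=> p k x z _ Ix _ Iz; rewrite /inv (dbl y) Ix Iz -(invl y).
  - move=> p r x z hx Ix hz Iz; rewrite /inv delta_mul (linD _ _ (brl y)).
    have hdy := delta_homog phi hy.
    have hdx := delta_homog phi hx; have hdz := delta_homog phi hz.
    rewrite !(bid_derl brP hx hz hy, bid_derl brP hdx hz hy,
      bid_derl brP hx hdz hy, bid_derl brP hx hz hdy).
    rewrite (linD _ _ dl) (linZ _ _ dl) !delta_mul Ix Iz.
    rewrite (linD _ _ (linear_mull z)) (linD _ _ (linear_mulr x)) !scalerDr.
    by rewrite [LHS](AC ((1*2)*3) (((1*4)*(2*6))*(3*5))).
move=> x y.
rewrite [x]hcomp_sum (lin_sum (dbl y)) (lin_sum (invl y)).
apply: eq_bigr => p _; rewrite -/(inv _ _) /inv.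
rewrite [y]hcomp_sum (lin_sum (dbr _)) (lin_sum (invr _)).
by apply: eq_bigr => q _; apply: Hl; apply: hcomp_homog.
Qed.

End Invariance.

(** * The induced bracket *)

Section InducedBracket.
Context {K : comPzRingType} {A : gradedAlgType K} {M : counitalCoalgType K}.
Local Notation AM := (repalg A M).
Variables (n : int) (D : {linear tensor A A -> tensor A A}).
Variables (v : {linear tensor M M -> K^o}) (br : {linear tensor AM AM -> AM}).
Hypotheses (vc : cyclic_form v) (brP : induced_bracket n D v br).

Let m (z : tensor A A) (b c : M) : AM :=
  tsum (fun x y => (rgen x b : AM) ⋅ rgen y c) z.

Let ml z c : linear (fun b => m z b c).
Proof.
apply: tsum_plin => x y.
exact: linear_comp (linear_mull _) ((rgen_bilin A M).2 x).
Qed.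

Let mr z b : linear (m z b).
Proof.
apply: tsum_plin => x y.
exact: linear_comp (linear_mulr _) ((rgen_bilin A M).2 y).
Qed.

Let delta_m (phi : {linear M -> K^o}) z b c :
  delta phi (m z b c) = m z (deltaM phi b) c + m z b (deltaM phi c).
Proof.
rewrite /m (lin_tsum _ _ (delta_linear phi)) -tsumD; apply: eq_tsum => x y.
by rewrite delta_mul !delta_gen.
Qed.

Lemma induced_bracket_gen_invariant (phi : {linear M -> K^o}) (a b : A)
    (al be : M) :
  delta phi (br (rgen a al ⊗ rgen b be)) =
  br (rgen a (deltaM phi al) ⊗ rgen b be)
  + br (rgen a al ⊗ rgen b (deltaM phi be)).
Proof.
have [_ brE] := brP; rewrite !brE; set z := D (a ⊗ b).
have dl := delta_linear (A := A) phi.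
have vl c : linear (fun b2 : M => v (c ⊗ b2)).
  exact: linear_comp (linear_linmap v) (linear_tensr c (@linear_idfun K M)).
pose g c (b1 b2 b3 : M) : AM := (v (c ⊗ b2) : K) *: m z b1 b3.
have tg c : trilin (g c).
  by split=> *; [exact: linear_scr|exact: linear_sc|exact: linear_scr].
have -> : delta phi (tsum3 (g al) (comul3 be)) =
    tsum3 (fun b1 b2 b3 => g al (deltaM phi b1) b2 b3) (comul3 be)
  + tsum3 (fun b1 b2 b3 => g al b1 b2 (deltaM phi b3)) (comul3 be).
  rewrite /tsum3 (lin_tsum _ _ dl) -tsumD; apply: eq_tsum => y b3.
  rewrite (lin_tsum _ _ dl) -tsumD; apply: eq_tsum => b1 b2.
  by rewrite (linZ _ _ dl) delta_m scalerDr.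
(* The term with [deltaM phi] on [b2] is cancelled by the bracket of
   [rgen a (deltaM phi al)], by invariance of [v]. *)
rewrite -[X in _ = _ + X]/(tsum3 (g al) _) (comul3_coder phi _ _ (tg al)).
have -> : tsum3 (g (deltaM phi al)) (comul3 be) =
    - tsum3 (fun b1 b2 b3 => g al b1 (deltaM phi b2) b3) (comul3 be).
  rewrite /tsum3 -tsumN; apply: eq_tsum => y b3.
  rewrite -tsumN; apply: eq_tsum => b1 b2; rewrite /g -scaleNr.
  congr (_ *: _); apply/eqP; rewrite -addr_eq0; apply/eqP.
  exact: cyclic_form_deltaM vc phi al b2.
by rewrite [RHS]addrC [X in X - _]addrAC addrK.
Qed.

End InducedBracket.

Theorem theorem8p2 (K : comPzRingType) (A : gradedAlgType K)
    (M : counitalCoalgType K) (n : int)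
    (D : {linear tensor A A -> tensor A A}) (v : {linear tensor M M -> K^o})
    (br : {linear tensor (repalg A M) (repalg A M) -> repalg A M}) :
  double_bracket n D -> cyclic_form v -> induced_bracket n D v br ->
  action_invariant br /\
  (forall x y : repalg A M,
     repalg_inv x -> repalg_inv y -> repalg_inv (br (x ⊗ y))).
Proof.
move=> _ vc brP.
have inv : action_invariant br.
  move=> phi; apply: (biderivation_invariant n br brP.1).
  exact: (induced_bracket_gen_invariant n D v br vc brP).
split=> // x y hx hy phi; rewrite inv hx hy.
have il := @linear_idfun K (repalg A M); have brl := linear_linmap br.
rewrite (linear0_map (linear_comp brl (linear_tensl y il))).
by rewrite (linear0_map (linear_comp brl (linear_tensr x il))) addr0.
Qed.
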